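(* Let $\gamma$ be an anisotropy function and $\beta\in C^2(\mathbb R^{d+1},\mathbb R_{>0})$ a kinetic function (see context). Let $\Gamma[X]$ be a sufficiently smooth solution of the anisotropic mean curvature flow, i.e. $\partial_tX=v\circ X$ on $\Gamma^0\times(0,T)$ with $v=V\nu$, $\beta(\nu)V=-H_\gamma=-\nabla_\Gamma\cdot(\gamma'(\nu))$, and $X(\cdot,0)=\mathrm{id}_{\Gamma^0}$. Then the normal vector $\nu$ and normal velocity $V$ satisfy $$\beta(\nu)\,\partial^\bullet\nu=\nabla_\Gamma\cdot\big(\gamma''(\nu)\nabla_\Gamma\nu\big)+|A|^2_{\gamma''}\,\nu+V\,\nabla_\Gamma\nu\,\beta'(\nu),$$ $$\beta(\nu)\,\partial^\bullet V=\nabla_\Gamma\cdot\big(\gamma''(\nu)\nabla_\Gamma V\big)+|A|^2_{\gamma''}V+V\,\nabla_\Gamma V\cdot\beta'(\nu),$$ where $|A|^2_{\gamma''}=\nabla_\Gamma\nu:(\gamma''(\nu)\nabla_\Gamma\nu)$.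
   Context: $d\in\{1,2,3\}$. $X:\Gamma^0\times[0,T]\to\mathbb R^{d+1}$ is smooth, $X(\cdot,t)$ is a diffeomorphism from the closed embedded hypersurface $\Gamma^0$ onto the closed embedded oriented hypersurface $\Gamma[X]=\Gamma(t)=\{X(p,t):p\in\Gamma^0\}$; $\nu$ is the (outward) unit normal of $\Gamma(t)$. The velocity $v$ satisfies $\partial_tX(p,t)=v(X(p,t),t)$, and the material derivative is $\partial^\bullet w(x,t)=\frac{d}{dt}w(X(p,t),t)$ at $x=X(p,t)$. $\nabla_\Gamma u=(D_1u,\dots,D_{d+1}u)^T$ is the tangential gradient (column vector); for vector fields $(\nabla_\Gamma w)_{ij}=D_iw_j$ and $\nabla_\Gamma\cdot w=\mathrm{tr}(\nabla_\Gamma w)$; the divergence of a matrix field is column-wise, $(\nabla_\Gamma\cdot M)_j=\sum_iD_iM_{ij}$. $A=\nabla_\Gamma\nu$; $A:B=\mathrm{tr}(AB^T)$ for matrices. An anisotropy function is $\gamma\in C^0(\mathbb R^{d+1},\mathbb R_{\ge0})\cap C^4(\mathbb R^{d+1}\setminus\{0\},\mathbb R_{>0})$, positively homogeneous of degree one, and strongly convex: there is $c_0>0$ with $w\cdot\gamma''(z)w\ge c_0|w|^2$ whenever $|z|=1$, $z\cdot w=0$. $\gamma',\gamma''$ denote gradient and Hessian of $\gamma$, $\beta'$ the gradient of $\beta$. *)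

(* Defs.v *)
From mathcomp Require Import all_boot all_order all_algebra.
From mathcomp Require Import all_classical all_reals all_analysis.

Set Implicit Arguments.
Unset Strict Implicit.
Unset Printing Implicit Defensive.

Import Order.TTheory GRing.Theory Num.Theory.
Import numFieldNormedType.Exports.

Local Open Scope classical_set_scope.
Local Open Scope ring_scope.

(** Euclidean products.  The library norm `|x| on matrices is the sup norm, so
    Euclidean lengths are always expressed through [dotv]. *)

Definition dotv (R : realType) (n : nat) (u w : 'cV[R]_n) : R :=
  \sum_i u i 0 * w i 0.

Definition ddot (R : realType) (m n : nat) (A B : 'M[R]_(m, n)) : R :=
  \tr (A *m B^T).

(* Only meant for open [U] and finite-dimensional [V]: C^(k+1) means
   differentiable on [U] with all directional derivatives of class C^k. *)
Fixpoint Ck_in (R : realType) (V W : normedModType R) (k : nat)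
    (U : set V) (f : V -> W) : Prop :=
  if k is k'.+1 then
    (forall x, U x -> differentiable f x) /\
    (forall v : V, Ck_in k' U (fun x => 'D_v f x))
  else forall x, U x -> {for x, continuous f}.

(* Class C^k on an arbitrary set: local C^k extensions to open sets. *)
Definition Ck_on (R : realType) (V W : normedModType R) (k : nat)
    (S : set V) (f : V -> W) : Prop :=
  forall x, S x -> exists (U : set V) (F : V -> W),
    [/\ open U, U x, Ck_in k U F & forall y, U y -> S y -> F y = f y].

Definition grad (R : realType) (n : nat) (f : 'cV[R]_n.+1 -> R)
    (x : 'cV[R]_n.+1) : 'cV[R]_n.+1 :=
  \col_i 'D_(delta_mx i 0) f x.

Definition hess (R : realType) (n : nat) (f : 'cV[R]_n.+1 -> R)
    (x : 'cV[R]_n.+1) : 'M[R]_n.+1 :=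
  \matrix_(i, j) 'D_(delta_mx j 0) (fun y => 'D_(delta_mx i 0) f y) x.

Definition closed_hypersurface (R : realType) (n k : nat)
    (M : set 'cV[R]_n.+1) : Prop :=
  compact M /\
  forall x, M x -> exists (U : set 'cV[R]_n.+1) (phi : 'cV[R]_n.+1 -> R),
    [/\ open U, U x, Ck_in k U phi,
        forall y, U y -> (M y <-> phi y = 0) &
        forall y, U y -> M y -> grad phi y != 0].

Definition tangent_vector (R : realType) (n : nat) (M : set 'cV[R]_n.+1)
    (x tau : 'cV[R]_n.+1) : Prop :=
  exists c : R -> 'cV[R]_n.+1,
    [/\ c 0 = x, \forall s \near (0 : R), M (c s) & is_derive (0 : R) 1 c tau].

Definition unit_normal (R : realType) (n : nat) (M : set 'cV[R]_n.+1)
    (nu : 'cV[R]_n.+1 -> 'cV[R]_n.+1) : Prop :=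
  forall x, M x -> dotv (nu x) (nu x) = 1 /\
    forall tau, tangent_vector M x tau -> dotv (nu x) tau = 0.

(* [M] is the boundary of a bounded open set, and [nu] points out of it. *)
Definition outward (R : realType) (n : nat) (M : set 'cV[R]_n.+1)
    (nu : 'cV[R]_n.+1 -> 'cV[R]_n.+1) : Prop :=
  exists Omega : set 'cV[R]_n.+1,
    [/\ open Omega, bounded_set Omega, closure Omega `\` Omega = M &
        forall x, M x -> \forall s \near (0 : R)^'+,
          Omega (x - s *: nu x) /\ ~ closure Omega (x + s *: nu x)].

(** Functions on a hypersurface [M] (with unit normal [nu]) are represented by functions on the ambient space,
    of which only the values on [M] matter. *)

(* The tangential gradient is the projection of the gradient of an extension. *)
Definition is_tgrad (R : realType) (n : nat) (M : set 'cV[R]_n.+1)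
    (nu : 'cV[R]_n.+1 -> 'cV[R]_n.+1) (u : 'cV[R]_n.+1 -> R)
    (x g : 'cV[R]_n.+1) : Prop :=
  exists ubar : 'cV[R]_n.+1 -> R,
    [/\ differentiable ubar x,
        \forall y \near x, M y -> ubar y = u y &
        g = grad ubar x - dotv (grad ubar x) (nu x) *: nu x].

(* On a hypersurface [is_tgrad] does not depend on the extension. *)
Definition tgrad (R : realType) (n : nat) (M : set 'cV[R]_n.+1)
    (nu : 'cV[R]_n.+1 -> 'cV[R]_n.+1) (u : 'cV[R]_n.+1 -> R)
    (x : 'cV[R]_n.+1) : 'cV[R]_n.+1 :=
  xget 0 [set g | is_tgrad M nu u x g].

(* Transposed Jacobian: the entry (i, j) is D_i w_j. *)
Definition tgradv (R : realType) (n m : nat) (M : set 'cV[R]_n.+1)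
    (nu : 'cV[R]_n.+1 -> 'cV[R]_n.+1) (w : 'cV[R]_n.+1 -> 'cV[R]_m)
    (x : 'cV[R]_n.+1) : 'M[R]_(n.+1, m) :=
  \matrix_(i, j) tgrad M nu (fun y => w y j 0) x i 0.

Definition tdiv (R : realType) (n : nat) (M : set 'cV[R]_n.+1)
    (nu : 'cV[R]_n.+1 -> 'cV[R]_n.+1) (w : 'cV[R]_n.+1 -> 'cV[R]_n.+1)
    (x : 'cV[R]_n.+1) : R :=
  \tr (tgradv M nu w x).

(* Column-wise: the entry j is the sum over i of D_i B_ij. *)
Definition tdivm (R : realType) (n m : nat) (M : set 'cV[R]_n.+1)
    (nu : 'cV[R]_n.+1 -> 'cV[R]_n.+1) (B : 'cV[R]_n.+1 -> 'M[R]_(n.+1, m))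
    (x : 'cV[R]_n.+1) : 'cV[R]_m :=
  \col_j tdiv M nu (fun y => col j (B y)) x.

(** A field on the evolving surface is a function
    of (x, t), used only for x on the surface at time t. *)

Definition surface (R : realType) (n : nat) (G0 : set 'cV[R]_n.+1)
    (X : 'cV[R]_n.+1 -> R -> 'cV[R]_n.+1) (t : R) : set 'cV[R]_n.+1 :=
  [set X p t | p in G0].

Definition evolving_surface (R : realType) (n k : nat) (T : R)
    (G0 : set 'cV[R]_n.+1) (X : 'cV[R]_n.+1 -> R -> 'cV[R]_n.+1) : Prop :=
  [/\ closed_hypersurface k G0,
      Ck_on k (G0 `*` `[0, T]%classic)
        (fun q : 'cV[R]_n.+1 * R => X q.1 q.2) &
      forall t, 0 <= t <= T ->
        closed_hypersurface k (surface G0 X t) /\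
        exists Y : 'cV[R]_n.+1 -> 'cV[R]_n.+1,
          Ck_on k (surface G0 X t) Y /\ forall p, G0 p -> Y (X p t) = p].

(* The orientation is transported continuously by the flow. *)
Definition outward_unit_normal (R : realType) (n : nat) (T : R)
    (G0 : set 'cV[R]_n.+1) (X : 'cV[R]_n.+1 -> R -> 'cV[R]_n.+1)
    (nu : 'cV[R]_n.+1 -> R -> 'cV[R]_n.+1) : Prop :=
  {within G0 `*` `[0, T]%classic,
     continuous (fun q : 'cV[R]_n.+1 * R => nu (X q.1 q.2) q.2)} /\
  forall t, 0 <= t <= T ->
    unit_normal (surface G0 X t) (fun y => nu y t) /\
    outward (surface G0 X t) (fun y => nu y t).

(* At the point X(p, t) and time t. *)
Definition matder (R : realType) (n : nat) (W : normedModType R)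
    (X : 'cV[R]_n.+1 -> R -> 'cV[R]_n.+1) (w : 'cV[R]_n.+1 -> R -> W)
    (p : 'cV[R]_n.+1) (t : R) : W :=
  derive1 (fun s : R => w (X p s) s) t.

Definition anisotropy (R : realType) (n : nat)
    (gamma : 'cV[R]_n.+1 -> R) : Prop :=
  [/\ continuous gamma /\ (forall z, 0 <= gamma z),
      Ck_in 4 [set z | z != 0] gamma /\ (forall z, z != 0 -> 0 < gamma z),
      forall (l : R) z, 0 < l -> gamma (l *: z) = l * gamma z &
      exists2 c0 : R, 0 < c0 & forall z w, dotv z z = 1 -> dotv z w = 0 ->
        c0 * dotv w w <= dotv w (hess gamma z *m w)].

Definition kinetic (R : realType) (n : nat) (beta : 'cV[R]_n.+1 -> R) : Prop :=
  Ck_in 2 setT beta /\ forall z, 0 < beta z.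

Definition aniso_curvature (R : realType) (n : nat)
    (gamma : 'cV[R]_n.+1 -> R) (M : set 'cV[R]_n.+1)
    (nu : 'cV[R]_n.+1 -> 'cV[R]_n.+1) (x : 'cV[R]_n.+1) : R :=
  tdiv M nu (fun y => grad gamma (nu y)) x.

Definition aniso_flow (R : realType) (n : nat)
    (gamma beta : 'cV[R]_n.+1 -> R) (T : R)
    (G0 : set 'cV[R]_n.+1) (X : 'cV[R]_n.+1 -> R -> 'cV[R]_n.+1)
    (nu v : 'cV[R]_n.+1 -> R -> 'cV[R]_n.+1)
    (V : 'cV[R]_n.+1 -> R -> R) : Prop :=
  (forall p, G0 p -> X p 0 = p) /\
  forall p t, G0 p -> 0 < t < T ->
    let x := X p t in
    [/\ is_derive t 1 (X p) (v x t),
        v x t = V x t *: nu x t &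
        beta (nu x t) * V x t =
          - aniso_curvature gamma (surface G0 X t) (fun y => nu y t) x].

(* |A|^2_(gamma'') with A the tangential gradient of [nu]. *)
Definition normA2 (R : realType) (n : nat)
    (gamma : 'cV[R]_n.+1 -> R) (M : set 'cV[R]_n.+1)
    (nu : 'cV[R]_n.+1 -> 'cV[R]_n.+1) (x : 'cV[R]_n.+1) : R :=
  ddot (tgradv M nu nu x) (hess gamma (nu x) *m tgradv M nu nu x).

(* Main.v *)
Require Import Defs.
From mathcomp Require Import all_boot all_order all_algebra.
From mathcomp Require Import all_classical all_reals all_analysis.
From mathcomp Require Import ring lra.
Set Implicit Arguments.
Unset Strict Implicit.
Unset Printing Implicit Defensive.
Import Order.TTheory GRing.Theory Num.Theory.
Import numFieldNormedType.Exports.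
Local Open Scope classical_set_scope.
Local Open Scope ring_scope.

(** Why the two equations hold.  Fix a label p on the initial surface and a time
    t, and work with functions of (label, time) near (p, t).  There the flow map
    has a C^3 extension [Xh], and adding a multiple of a function [phi] that
    defines the initial surface makes its label Jacobian invertible.  So [Xh] is,
    at each time, a change of coordinates from labels y to ambient points; it
    carries the level set phi = 0 to the moving surface, whose unit normal is the
    normalised ambient gradient of [phi].  In these terms the material derivative
    is the partial derivative in time, and the tangential gradient is the vector
    of first-order operators
      td_i = sum_m P_im d/dX_m,   P = I - N N^T
    ([tgrad_td]).  Evolution equations become statements about commutators of
    vector fields.

    A vector field is known from its values on the coordinates X_m, and
    td_i X_m = P_im.  Hence (with Schwarz's theorem, [derive_swap])
      [td_i, td_j] = sum_m (td_i P_jm - td_j P_im) d/dX_m,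
      [d_t, td_i]  = sum_m (d_t P_im - td_i (d_t X_m)) d/dX_m
    ([commutator_ambient_d], [time_commutator_ambient_d]).  Both td_i and d_t
    annihilate [phi], whose ambient gradient is a nonzero multiple of N.
    Evaluating the commutators at [phi] therefore yields all the geometry that is
    needed: A_ij = td_i N_j is symmetric ([shape_symmetric]), and d_t N = - td V
    for a surface that moves with normal velocity V ([time_derive_normal]).  What
    remains is [commutator_td] and [time_commutator_td].

    Put G_i = gamma_i(N), so that H_gamma = sum_i td_i G_i.  Since gamma is
    homogeneous of degree one, z^T gamma''(z) = 0 and so sum_i N_i dG_i = 0 for any
    derivation d ([derive_cahn_hoffman_orth]).  As A is symmetric, the entry
    (i, j) of gamma''(N) A is td_j G_i, and commuting the derivatives gives
      sum_i td_i (gamma'' A)_ij = td_j H_gamma - |A|^2 N_j    ([div_hess_shape]).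
    The tangential gradient of beta(N) V = - H_gamma is then the equation for the
    normal ([normal_evolution]).  In the same way
      d_t H_gamma = - sum_i td_i (gamma'' td V)_i - V |A|^2,
    because d_t G = gamma'' d_t N = - gamma'' td V on the surface, and the time
    derivative of the law is the equation for V ([velocity_evolution]).

    Two facts link this calculus with the surfaces.  Derivatives in the operators
    td_i depend only on values on the surface, and the projected gradient does not
    depend on the extension, because every vector tangent to a regular zero set is
    the velocity of a curve in it ([zero_set_curve]).  And the given normal field
    agrees with N near (p, t): it is orthogonal to the same tangent vectors, and
    continuity along the flow fixes the sign ([exists_flow_chart]). *)

(** * Functions of class C^k on open sets *)

Lemma near_eq_differentiable (R : realType) (V W : normedModType R)
    (f g : V -> W) (x : V) :
  (\forall y \near x, f y = g y) -> differentiable f x -> differentiable g x.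
Proof.
move=> fg df; have fgx : f x = g x by exact: nbhs_singleton fg.
have dfg : 'd g x = 'd f x :> (V -> W).
  apply: diff_unique; first exact: diff_continuous.
  apply/eqaddoP => e e0; have /diff_locally/eqaddoP/(_ e e0) H := df.
  near=> h; rewrite !fctE /= -fgx.
  have -> : g (h + x) = f (h + x); last by near: h; exact: H.
  apply/esym; near: h.
  by have := fg; rewrite (near_shift 0) subr0.
apply/diff_locallyP; split; rewrite dfg; first exact: diff_continuous.
apply/eqaddoP => e e0; have /diff_locally/eqaddoP/(_ e e0) H := df.
near=> h; rewrite !fctE /= -fgx.
have -> : g (h + x) = f (h + x); last by near: h; exact: H.
apply/esym; near: h.
by have := fg; rewrite (near_shift 0) subr0.
Unshelve. all: by end_near. Qed.

Lemma col_sum_delta (R : realType) n (z : 'cV[R]_n) :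
  z = \sum_i z i 0 *: delta_mx i 0.
Proof.
by rewrite [LHS]matrix_sum_delta; apply: eq_bigr => i _; rewrite big_ord1.
Qed.

Lemma derive_direction_sum (R : realType) (V W : normedModType R) (f : V -> W) (x : V)
    (I : finType) (c : I -> R) (v : I -> V) :
  differentiable f x -> 'D_(\sum_i c i *: v i) f x = \sum_i c i *: 'D_(v i) f x.
Proof.
move=> df; rewrite deriveE// linear_sum; apply: eq_bigr => i _.
by rewrite linearZ deriveE.
Qed.

Lemma derive_entry (R : realType) (V : normedModType R) m n (f : V -> 'M[R]_(m, n))
  x v i j : differentiable f x -> 'D_v (fun y => f y i j) x = ('D_v f x) i j.
Proof. by move=> df; rewrite derive_mx ?mxE//; exact: diff_derivable. Qed.

Lemma differentiable_entry (R : realType) (V : normedModType R) m n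
  (f : V -> 'M[R]_(m, n)) x i j :
  differentiable f x -> differentiable (fun y => f y i j) x.
Proof.
move=> df; apply: (@differentiable_comp _ _ _ _ f (fun M : 'M[R]_(m,n) => M i j)) => //.
exact: differentiable_coord.
Qed.

Lemma differentiable_col (R : realType) (V : normedModType R) n
  (f : V -> 'cV[R]_n) x :
  (forall i, differentiable (fun y => f y i 0) x) -> differentiable f x.
Proof.
move=> df.
have -> : f = \sum_(i < n) (fun y => f y i 0 *: (delta_mx i 0 : 'cV[R]_n)).
  by apply/funext => y; rewrite [LHS]col_sum_delta fct_sumE.
by apply: differentiable_sum => i; exact: differentiableZl.
Qed.

(** The chain rule in coordinates: this is the form in which compositions can be
    differentiated again, since each factor is a scalar function. *)
Lemma derive_comp_partials (R : realType) (V : normedModType R) n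
  (f : 'cV[R]_n -> R) (g : V -> 'cV[R]_n) x v :
  (forall i, differentiable (fun y => g y i 0) x) -> differentiable f (g x) ->
  'D_v (f \o g) x =
  \sum_i 'D_v (fun y => g y i 0) x * 'D_(delta_mx i 0) f (g x).
Proof.
move=> dg df; have dg' := differentiable_col dg.
rewrite deriveE; last exact: differentiable_comp.
rewrite diff_comp//= -!deriveE//.
have -> : 'D_v g x = \sum_i 'D_v (fun y => g y i 0) x *: delta_mx i 0.
  by rewrite [LHS]col_sum_delta; apply: eq_bigr => i _; rewrite derive_entry.
by rewrite derive_direction_sum.
Qed.

Section Ck.
Variables (R : realType) (V : normedModType R) (U : set V) (openU : open U).
Implicit Types (k : nat) (f g : V -> R).

Lemma open_near_in (P : set V) x : U x -> (forall y, U y -> P y) -> \forall y \near x, P y.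
Proof.
by move=> Ux UP; apply: filterS UP _; exact: open_nbhs_nbhs. Qed.

(** Openness matters: on an open set, equality on the set forces equality of all
    derivatives there. *)
Lemma Ck_in_eq (W : normedModType R) k (f g : V -> W) :
  (forall x, U x -> f x = g x) -> Ck_in k U f -> Ck_in k U g.
Proof.
elim: k f g => [|k IH] f g fg /=.
  move=> cf x Ux; have := cf x Ux; rewrite /prop_for /continuous_at -(fg x)//.
  apply: cvg_trans; apply: near_eq_cvg; exact: open_near_in.
move=> [df cf]; split.
  move=> x Ux; apply: near_eq_differentiable (df x Ux); exact: open_near_in.
move=> v; apply: IH (cf v) => x Ux; apply: near_eq_derive; exact: open_near_in.
Qed.

Lemma Ck_inS (W : normedModType R) k (f : V -> W) : Ck_in k.+1 U f -> Ck_in k U f.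
Proof.
elim: k f => [|k IH] f /=.
  by move=> [df _] x Ux; apply: differentiable_continuous; exact: df.
by move=> [df cf]; split => // v; apply: IH; exact: cf.
Qed.

Lemma Ck_in_le (W : normedModType R) k l (f : V -> W) : (l <= k)%N -> Ck_in k U f -> Ck_in l U f.
Proof.
elim: k => [|k IH]; first by rewrite leqn0 => /eqP ->.
by rewrite leq_eqVlt => /orP[/eqP ->//|]; rewrite ltnS => /IH + /Ck_inS; apply.
Qed.

Lemma Ck_in_differentiable (W : normedModType R) k (f : V -> W) x :
  (0 < k)%N -> Ck_in k U f -> U x -> differentiable f x.
Proof. by case: k => // k _ [+ _]; apply. Qed.

Lemma Ck_in_continuous (W : normedModType R) k (f : V -> W) x :
  Ck_in k U f -> U x -> {for x, continuous f}.
Proof. by move=> /(Ck_in_le (leq0n k)) /= ; apply. Qed.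

Lemma Ck_in_derive (W : normedModType R) k (f : V -> W) v :
  Ck_in k.+1 U f -> Ck_in k U (fun x => 'D_v f x).
Proof. by move=> [_ +]; apply. Qed.

Lemma Ck_in_subset (W : normedModType R) (U' : set V) k (f : V -> W) : U' `<=` U ->
  Ck_in k U f -> Ck_in k U' f.
Proof.
move=> UU'; elim: k f => [|k IH] f /=; first by move=> cf x /UU'; exact: cf.
by move=> [df cf]; split=> [x /UU'|v]; [exact: df | exact: IH].
Qed.

Lemma Ck_in_cst k (c : R) : Ck_in k U (fun=> c).
Proof.
elim: k c => [|k IH] c /=; first by move=> x _; exact: cst_continuous.
split=> [x _|v]; first exact: differentiable_cst.
by under eq_fun do rewrite derive_cst.
Qed.

Lemma Ck_in_add k f g : Ck_in k U f -> Ck_in k U g -> Ck_in k U (fun x => f x + g x).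
Proof.
elim: k f g => [|k IH] f g /=.
  by move=> cf cg x Ux; apply: continuousD; [exact: cf | exact: cg].
move=> [df cf] [dg cg]; split=> [x Ux|v].
  by apply: differentiableD; [exact: df | exact: dg].
apply: Ck_in_eq (IH _ _ (cf v) (cg v)) => x Ux /=.
by rewrite -deriveD//; apply: diff_derivable; [exact: df | exact: dg].
Qed.

Lemma Ck_in_mul k f g : Ck_in k U f -> Ck_in k U g -> Ck_in k U (fun x => f x * g x).
Proof.
elim: k f g => [|k IH] f g.
  by move=> /= cf cg x Ux; apply: continuousM; [exact: cf | exact: cg].
move=> Cf Cg; have [/= df cf] := Cf; have [/= dg cg] := Cg; split=> [x Ux|v].
  by apply: differentiableM; [exact: df | exact: dg].
apply: (@Ck_in_eq _ _ (fun x => f x * 'D_v g x + g x * 'D_v f x)).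
  by move=> x Ux; rewrite deriveM//; apply: diff_derivable; [exact: df | exact: dg].
by apply: Ck_in_add; apply: IH; (exact: Ck_inS || exact: cg || exact: cf).
Qed.

Lemma Ck_in_opp k f : Ck_in k U f -> Ck_in k U (fun x => - f x).
Proof.
move=> cf; apply: (Ck_in_eq _ (Ck_in_mul (Ck_in_cst k (-1)) cf)).
by move=> x Ux; rewrite mulN1r.
Qed.

Lemma Ck_in_sum k (I : Type) (r : seq I) (f : I -> V -> R) :
  (forall i, Ck_in k U (f i)) -> Ck_in k U (fun x => \sum_(i <- r) f i x).
Proof.
move=> cf; elim: r => [|i r IH].
  by under eq_fun do rewrite big_nil; exact: Ck_in_cst.
under eq_fun do rewrite big_cons.
by apply: Ck_in_add.
Qed.

Lemma Ck_in_prod k (I : Type) (r : seq I) (f : I -> V -> R) :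
  (forall i, Ck_in k U (f i)) -> Ck_in k U (fun x => \prod_(i <- r) f i x).
Proof.
move=> cf; elim: r => [|i r IH].
  by under eq_fun do rewrite big_nil; exact: Ck_in_cst.
under eq_fun do rewrite big_cons.
by apply: Ck_in_mul.
Qed.

Lemma Ck_in_inv k f : (forall x, U x -> f x != 0) ->
  Ck_in k U f -> Ck_in k U (fun x => (f x)^-1).
Proof.
move=> f0; elim: k => [|k IH].
  by move=> cf x Ux; apply: continuousV; [exact: f0 | exact: cf].
move=> Cf; have [df cf] := Cf; have Cfk := IH (Ck_inS Cf).
split=> [x Ux|v].
  by apply: differentiableV; [exact: df | exact: f0].
apply: (@Ck_in_eq _ _ (fun x => - ((f x)^-1 * (f x)^-1) * 'D_v f x)).
  move=> x Ux; rewrite deriveV ?f0//; last by apply: diff_derivable; exact: df.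
  by rewrite /GRing.scale /= -exprVn.
by apply: Ck_in_mul (cf v); apply: Ck_in_opp; apply: Ck_in_mul.
Qed.

Lemma Ck_in_sqrt k f : (forall x, U x -> 0 < f x) ->
  Ck_in k U f -> Ck_in k U (fun x => Num.sqrt (f x)).
Proof.
move=> f0; elim: k => [|k IH].
  move=> cf x Ux; apply: (@continuous_comp _ _ _ f Num.sqrt); first exact: cf.
  exact: sqrt_continuous.
move=> Cf; have [df cf] := Cf; have Cfk := IH (Ck_inS Cf).
have ds x : U x -> differentiable Num.sqrt (f x).
  move=> Ux; apply/derivable1_diffP; apply: ex_derive; apply: is_derive1_sqrt; exact: f0.
split=> [x Ux|v].
  by apply: (@differentiable_comp _ _ _ _ f Num.sqrt); [exact: df | exact: ds].
apply: (@Ck_in_eq _ _ (fun x => (2 * Num.sqrt (f x))^-1 * 'D_v f x)).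
  move=> x Ux; rewrite [RHS](@deriveE _ _ _ (Num.sqrt \o f)); last first.
    by apply: differentiable_comp; [exact: df | exact: ds].
  rewrite diff_comp/=; [|exact: df|exact: ds].
  rewrite -(deriveE v); last exact: df.
  rewrite -[in RHS](mulr1 ('D_v f x)) -[_ * 1]/(_ *: _) linearZ -deriveE; last exact: ds.
  by rewrite derive_sqrt ?f0// mulrC.
apply: Ck_in_mul (cf v); apply: Ck_in_inv.
  by move=> x Ux; rewrite mulf_neq0// gt_eqF// sqrtr_gt0 f0.
by apply: Ck_in_mul => //; exact: Ck_in_cst.
Qed.

Lemma Ck_in_coord k m n (f : V -> 'M[R]_(m, n)) i j : Ck_in k U f ->
  Ck_in k U (fun x => f x i j).
Proof.
elim: k f => [|k IH] f /=.
  move=> cf x Ux; apply: (@continuous_comp _ _ _ f (fun M : 'M[R]_(m,n) => M i j)); first exact: cf.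
  exact: coord_continuous.
move=> [df cf]; split => [x Ux|v]; first by apply: differentiable_entry; exact: df.
apply: Ck_in_eq (IH _ (cf v)) => x Ux.
by rewrite derive_entry//; exact: df.
Qed.

(** By [derive_comp_partials] a derivative of a composition is a sum of products of
    functions of the previous class. *)
Lemma Ck_in_comp k n (W : set 'cV[R]_n) (f : 'cV[R]_n -> R) (g : V -> 'cV[R]_n) :
  (forall x, U x -> W (g x)) -> Ck_in k W f ->
  (forall i, Ck_in k U (fun x => g x i 0)) -> Ck_in k U (fun x => f (g x)).
Proof.
move=> gW; elim: k f => [|k IH] f.
  move=> cf cg x Ux; apply: (@continuous_comp _ _ _ g f); last exact/cf/gW.
  have -> : g = \sum_(i < n) (fun y => g y i 0 *: (delta_mx i 0 : 'cV[R]_n)).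
    by apply/funext => y; rewrite [LHS]col_sum_delta fct_sumE.
  apply: (@big_ind _ (fun h : V -> 'cV[R]_n => {for x, continuous h})).
  - exact: cst_continuous.
  - by move=> a b ca cb; exact: continuousD.
  - move=> i _; apply: continuousZl; exact: cg.
move=> [df cf] Cg.
have dg x i : U x -> differentiable (fun y => g y i 0) x.
  by move=> Ux; have [+ _] := Cg i; apply.
split=> [x Ux|v].
  apply: (@differentiable_comp _ _ _ _ g f); last exact/df/gW.
  by apply: differentiable_col => i; exact: dg.
apply: (@Ck_in_eq _ _ (fun x => \sum_i 'D_v (fun y => g y i 0) x * 'D_(delta_mx i 0) f (g x))).
  move=> x Ux; rewrite -derive_comp_partials//; first by move=> i; exact: dg.
  exact/df/gW.
apply: Ck_in_sum => i; apply: Ck_in_mul; first by have [_ +] := Cg i; apply.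
apply: (IH ('D_(delta_mx i 0) f)); first exact: cf.
by move=> j; apply: Ck_inS; exact: Cg.
Qed.

End Ck.

(** * Symmetry of second derivatives, and products with a time axis *)

Lemma is_derive_curve (R : realType) (V W : normedModType R) (f : V -> W)
    (c : R -> V) (s : R) (tau : V) :
  is_derive s 1 c tau -> differentiable f (c s) ->
  is_derive s 1 (f \o c) ('D_tau f (c s)).
Proof.
move=> dc df; have dcs : differentiable c s by apply/derivable1_diffP; exact: ex_derive.
have dfc : differentiable (f \o c) s by exact: differentiable_comp.
apply: DeriveDef; first exact: diff_derivable.
have [_ dce] := dc.
by rewrite deriveE// diff_comp//= -(deriveE _ dcs) dce deriveE.
Qed.

Lemma is_derive_line (R : realType) (V : normedModType R) (a u : V) (s : R) :
  is_derive s 1 (fun s : R => a + s *: u) u.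
Proof.
have -> : (fun s : R => a + s *: u) = cst a + ( *:%R^~ u) by apply/funext.
have d : differentiable ( *:%R^~ u : R -> V) s by exact: ex_diff.
rewrite -[u in is_derive _ _ _ u]add0r; apply: is_deriveD.
apply: DeriveDef; first exact: diff_derivable.
by rewrite deriveE// diff_val scale1r.
Qed.

Section schwarz.
Variables (R : realType) (V : normedModType R).
Implicit Types (f : V -> R) (U : set V).

(** The mixed second difference over a parallelogram, evaluated with the mean value
    theorem once in each direction. *)
Lemma double_MVT U f q u v h : 0 < h -> Ck_in 2 U f ->
  (forall s r, 0 <= s <= h -> 0 <= r <= h -> U (q + s *: u + r *: v)) ->
  exists s r, [/\ 0 <= s <= h, 0 <= r <= h &
    f (q + h *: u + h *: v) - f (q + h *: u) - f (q + h *: v) + f q =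
    'D_v ('D_u f) (q + s *: u + r *: v) * h * h].
Proof.
move=> h0 [df ddf] Uq; have [ddu _] := ddf u.
have dfl a s : U (a + s *: u) -> is_derive s 1 (fun s => f (a + s *: u)) ('D_u f (a + s *: u)).
  move=> Ua; apply: (is_derive_curve (is_derive_line a u s)); exact: df.
have dul a s : U (a + s *: v) -> is_derive s 1 (fun s => 'D_u f (a + s *: v)) ('D_v ('D_u f) (a +
    s *: v)).
  move=> Ua; apply: (is_derive_curve (is_derive_line a v s)); exact: ddu.
have hh : 0 <= h <= h by rewrite lexx ltW.
have h00 : 0 <= (0:R) <= h by rewrite lexx ltW.
have der1 s : 0 <= s <= h -> is_derive s 1
    (fun s => f (q + h *: v + s *: u) - f (q + s *: u))
    ('D_u f (q + h *: v + s *: u) - 'D_u f (q + s *: u)).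
  move=> sh; apply: is_deriveB; apply: dfl.
    by rewrite addrAC; exact: Uq.
  by have := Uq s 0 sh h00; rewrite scale0r addr0.
have mvt (g dg : R -> R) : (forall s, 0 <= s <= h -> is_derive s 1 g (dg s)) ->
    exists2 s, 0 <= s <= h & g h - g 0 = dg s * h.
  move=> H; have [s||s + e] := @MVT R g dg 0 h h0.
  - by rewrite in_itv/= => /andP[s0 sh]; apply: H; rewrite !ltW.
  - apply: derivable_within_continuous => s; rewrite in_itv/= => /H dgs.
    exact: ex_derive.
  - by rewrite in_itv/= => /andP[s0 sh]; exists s; rewrite ?ltW// e subr0.
have [s sh e1] := mvt _ _ der1.
have der2 r : 0 <= r <= h -> is_derive r 1
    (fun r => 'D_u f (q + s *: u + r *: v)) ('D_v ('D_u f) (q + s *: u + r *: v)).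
  by move=> rh; apply: dul; exact: Uq.
have [r rh e2] := mvt _ _ der2.
exists s, r; split => //.
move: e1 e2; rewrite !scale0r !addr0 => e1 e2; rewrite -e2.
by rewrite [in q + s *: u + h *: v]addrAC -e1 [in q + h *: u + h *: v]addrAC; ring.
Qed.

(** Two continuous functions agree at [q] as soon as, in each small parallelogram at
    [q], some value of the one equals some value of the other. *)
Lemma eq_of_near_values U (a b : V -> R) q u v : open U -> U q ->
  {for q, continuous a} -> {for q, continuous b} ->
  (forall h, 0 < h ->
    (forall s r, 0 <= s <= h -> 0 <= r <= h -> U (q + s *: u + r *: v)) ->
    exists s r s' r', [/\ 0 <= s <= h, 0 <= r <= h, 0 <= s' <= h, 0 <= r' <= h &
      a (q + s *: u + r *: v) = b (q + s' *: u + r' *: v)]) ->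
  a q = b q.
Proof.
move=> openU Uq ca cb H.
apply/eqP; rewrite -subr_eq0 -normr_le0; apply/ler_addgt0Pr => e e0; rewrite add0r.
have e20 : 0 < e / 2 by rewrite divr_gt0.
have N1 : \forall y \near q, U y by exact: open_nbhs_nbhs.
have N2 : \forall y \near q, `|a q - a y| < e / 2.
  by have /cvgrPdist_lt/(_ _ e20) := ca.
have N3 : \forall y \near q, `|b q - b y| < e / 2.
  by have /cvgrPdist_lt/(_ _ e20) := cb.
have N : \forall y \near q, [/\ U y, `|a q - a y| < e / 2 & `|b q - b y| < e / 2].
  by apply: filterS3 N1 N2 N3 => y.
have [r /= r0 Nr] := (nbhs_ballP _ _).1 N.
(* The parallelogram of side h stays in the ball of radius r. *)
pose h := r / (2 * (`|u| + `|v| + 1)).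
have nuv : 0 < `|u| + `|v| + 1 by rewrite ltr_wpDl// addr_ge0.
have h0 : 0 < h by rewrite divr_gt0// mulr_gt0.
have inball s t : 0 <= s <= h -> 0 <= t <= h -> ball q r (q + s *: u + t *: v).
  move=> /andP[s0 sh] /andP[t0 th]; rewrite -ball_normE /ball_/= -addrA opprD addrA subrr add0r
      normrN.
  apply: le_lt_trans (ler_normD _ _) _; rewrite !normrZ !ger0_norm//.
  apply: (@le_lt_trans _ _ (h * (`|u| + `|v| + 1))).
    have := normr_ge0 u; have := normr_ge0 v; nra.
  have -> : h * (`|u| + `|v| + 1) = r / 2 by rewrite /h; field; rewrite gt_eqF.
  by rewrite ltr_pdivrMr// ltr_pMr// ltr1n.
have [s|s [t [s' [t' [sh th sh' th' e1]]]]] := H h h0.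
  by move=> t sh th; have [] := Nr _ (inball s t sh th).
have [_ b1 _] := Nr _ (inball s t sh th).
have [_ _ b2] := Nr _ (inball s' t' sh' th').
apply: ltW; rewrite (splitr e) -(subrKA (a (q + s *: u + t *: v))).
by apply: le_lt_trans (ler_normD _ _) _; rewrite ltrD// distrC e1.
Qed.

(** Schwarz's theorem: the second difference is symmetric in the two directions, so
    [double_MVT] in both orders makes the two mixed derivatives share values
    arbitrarily near [q]. *)
Lemma derive_swap U f q u v : open U -> U q -> Ck_in 2 U f ->
  'D_v ('D_u f) q = 'D_u ('D_v f) q.
Proof.
move=> openU Uq Cf; have [_ ddf] := Cf.
have cuv w z : {for q, continuous ('D_w ('D_z f))}.
  by have [_ /(_ w)/(_ q Uq)] := ddf z.
apply: (@eq_of_near_values U ('D_v ('D_u f)) ('D_u ('D_v f)) q u v openU Uq).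
- exact: cuv.
- exact: cuv.
move=> h h0 inU.
have inU' s t : 0 <= s <= h -> 0 <= t <= h -> U (q + s *: v + t *: u).
  by move=> sh th; rewrite addrAC; exact: inU.
have [s [t [sh th]]] := double_MVT h0 Cf inU.
have [s' [t' [sh' th']]] := double_MVT h0 Cf inU'.
move: ('D_v ('D_u f)) ('D_u ('D_v f)) => a b e2 e1.
clear cuv ddf Cf.
exists s, t, t', s'; split; [exact: sh|exact: th|exact: th'|exact: sh'|].
have hn : h != 0 by rewrite gt_eqF.
apply: (mulIf hn) => /=; apply: (mulIf hn) => /=.
rewrite [q + t' *: u + _]addrAC.
apply: etrans (esym e1) _; apply: etrans _ e2.
by rewrite [q + h *: u + _]addrAC; congr (_ + _); exact: addrAC.
Qed.

End schwarz.

Section product_space.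
Variables (R : realType) (V : normedModType R).

Lemma derive_fst (W : normedModType R) (f : V -> W) (q v : V * R) :
  differentiable f q.1 -> 'D_v (fun q : V * R => f q.1) q = 'D_(v.1) f q.1.
Proof.
move=> df; have dfst : differentiable (fst : V * R -> V) q.
  apply: linear_differentiable => z; exact: cvg_fst.
rewrite -[(fun _ => _)]/(f \o fst) [LHS]deriveE; last exact: differentiable_comp.
rewrite diff_comp//= -!deriveE//; congr ('D_ _ _ _).
rewrite deriveE// diff_lin// => z; exact: cvg_fst.
Qed.

Lemma Ck_in_fst (W : normedModType R) k (U : set V) (f : V -> W) : open U -> Ck_in k U f ->
  Ck_in k [set q : V * R | U q.1] (fun q : V * R => f q.1).
Proof.
move=> openU.
have openU1 : open [set q : V * R | U q.1].
  apply: open_comp openU => q _; exact: cvg_fst.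
have dfst q : differentiable (fst : V * R -> V) q.
  apply: linear_differentiable => z; exact: cvg_fst.
elim: k f => [|k IH] f /=.
  move=> cf q Uq; apply: (@continuous_comp _ _ _ fst f); first exact: cvg_fst.
  exact: cf.
move=> [df cf]; split => [q Uq|v].
  by apply: (@differentiable_comp _ _ _ _ fst f) => //; exact: df.
apply: Ck_in_eq (IH _ (cf v.1)); first exact: openU1.
move=> q Uq; rewrite derive_fst; [by []|exact: df].
Qed.

Lemma differentiable_slice (W : normedModType R) (F : V * R -> W) (p : V) (t : R) :
  differentiable F (p, t) -> differentiable (fun y => F (y, t)) p.
Proof.
move=> dF; apply: (@differentiable_comp _ _ _ _ (fun y => (y, t)) F) => //.
Qed.

Lemma is_derive_time (W : normedModType R) (F : V * R -> W) (p : V) (t : R) :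
  differentiable F (p, t) ->
  is_derive t 1 (fun s => F (p, s)) ('D_(0, 1) F (p, t)).
Proof.
move=> dF.
have := @is_derive_curve _ _ _ F (fun s => (p, s)) t (0, 1); apply => //.
have dp : is_diff t (fun s : R => (p, s)) (fun s : R => (0, s)) by exact: is_diff_pair.
have dd : differentiable (fun s : R => (p, s)) t by exact: ex_diff.
by apply: DeriveDef; [exact: diff_derivable | rewrite deriveE// (diff_val (is_diff_def := dp))].
Qed.

End product_space.

(** * Differential operators in label coordinates and their commutators *)

Section derive_rules.
Variables (R : realType) (V : normedModType R).
Implicit Types (f g : V -> R) (q v : V).

Lemma derive_addf f g q v : differentiable f q -> differentiable g q ->
  'D_v (fun x => f x + g x) q = 'D_v f q + 'D_v g q.
Proof. by move=> df dg; apply: deriveD; apply: diff_derivable. Qed.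

Lemma derive_oppf f q v : differentiable f q -> 'D_v (fun x => - f x) q = - 'D_v f q.
Proof. by move=> df; apply: deriveN; apply: diff_derivable. Qed.

Lemma derive_mulf f g q v : differentiable f q -> differentiable g q ->
  'D_v (fun x => f x * g x) q = 'D_v f q * g q + f q * 'D_v g q.
Proof.
move=> df dg; rewrite -[(fun _ => _)]/(f * g) deriveM; [|exact: diff_derivable..].
by rewrite addrC; congr (_ + _); exact: mulrC.
Qed.

Lemma differentiable_sumf n (f : 'I_n -> V -> R) q :
  (forall i, differentiable (f i) q) -> differentiable (fun x => \sum_i f i x) q.
Proof.
move=> df; rewrite (_ : (fun _ => _) = \sum_i f i).
  exact: differentiable_sum.
by apply/funext => x; rewrite fct_sumE.
Qed.

Lemma derive_sumf n (f : 'I_n -> V -> R) q v : (forall i, differentiable (f i) q) ->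
  'D_v (fun x => \sum_i f i x) q = \sum_i 'D_v (f i) q.
Proof.
move=> df; have -> : (fun x => \sum_i f i x) = \sum_i f i by apply/funext => x; rewrite fct_sumE.
by rewrite derive_sum// => i; exact: diff_derivable.
Qed.

End derive_rules.

Section adapted_chart.
Variables (R : realType) (n : nat).
Notation E := ('cV[R]_n * R)%type.

(** Points of [E] are pairs (label, time); derivatives along these directions are the
    partial derivatives in the labels and in time. *)
Definition label_dir (k : 'I_n) : E := (delta_mx k 0, 0).
Definition time_dir : E := (0, 1).

(** [X] is a change from labels to ambient coordinates with inverse Jacobian matrix
    [L] (transposed), so that sum_k L_mk d/dy_k is d/dX_m.  The ambient gradient of
    [phi] is [r] times the unit vector field [N]: at each time, [N] is normal to the
    image of the level sets of [phi]. *)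
Record adapted_chart (W : set E) (X N : 'I_n -> E -> R)
    (L : 'I_n -> 'I_n -> E -> R) (phi r : E -> R) : Prop := AdaptedChart {
  chart_open : open W;
  chart_CX : forall i, Ck_in 3 W (X i);
  chart_CN : forall i, Ck_in 2 W (N i);
  chart_CL : forall i j, Ck_in 2 W (L i j);
  chart_Cphi : Ck_in 2 W phi;
  chart_LX : forall q, W q -> forall m j,
    \sum_k L m k q * 'D_(label_dir k) (X j) q = (m == j)%:R;
  chart_XL : forall q, W q -> forall l k,
    \sum_m 'D_(label_dir l) (X m) q * L m k q = (l == k)%:R;
  chart_Lphi : forall q, W q -> forall m,
    \sum_k L m k q * 'D_(label_dir k) phi q = r q * N m q;
  chart_r0 : forall q, W q -> r q != 0;
  chart_N1 : forall q, W q -> \sum_i N i q * N i q = 1;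
  chart_phit : forall q, W q -> 'D_time_dir phi q = 0
}.

Variables (W : set E) (X N : 'I_n -> E -> R).
Variables (L : 'I_n -> 'I_n -> E -> R) (phi r : E -> R).
Hypothesis chart : adapted_chart W X N L phi r.
Implicit Types (F : E -> R) (q : E).
Let openW := chart_open chart.
Let CX := chart_CX chart.
Let CN := chart_CN chart.
Let CL := chart_CL chart.
Let LX := chart_LX chart.
Let XL := chart_XL chart.

Definition tangent_proj (i m : 'I_n) (q : E) : R := (i == m)%:R - N i q * N m q.
Definition td_coef (i k : 'I_n) (q : E) : R := \sum_m tangent_proj i m q * L m k q.
(** The tangential derivative [td i] is the directional derivative along the label
    vector that [X] maps to the i-th column of the tangential projection. *)
Definition td_dir (i : 'I_n) (q : E) : E := \sum_k td_coef i k q *: label_dir k.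
Definition td (i : 'I_n) (F : E -> R) (q : E) : R := 'D_(td_dir i q) F q.
(** The derivative d/dX_m in the ambient coordinates. *)
Definition ambient_d (m : 'I_n) (F : E -> R) (q : E) : R := \sum_k L m k q * 'D_(label_dir k) F q.

Lemma differentiable_chart k F q : W q -> Ck_in k.+1 W F -> differentiable F q.
Proof. by move=> Wq CF; exact: (Ck_in_differentiable (ltn0Sn k) CF Wq). Qed.

Lemma tdE i F q : differentiable F q ->
  td i F q = \sum_k td_coef i k q * 'D_(label_dir k) F q.
Proof. by move=> dF; rewrite /td derive_direction_sum. Qed.

Lemma td_ambient_d i F q : differentiable F q -> td i F q = \sum_m tangent_proj i m q * ambient_d
    m F q.
Proof.
move=> dF; rewrite tdE// /td_coef /ambient_d.
under eq_bigr do rewrite mulr_suml.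
rewrite exchange_big; apply: eq_bigr => m _; rewrite mulr_sumr.
by apply: eq_bigr => k _; rewrite mulrA.
Qed.

Lemma Ck_in_tangent_proj i m : Ck_in 2 W (tangent_proj i m).
Proof.
apply: Ck_in_add; first exact: openW.
  exact: Ck_in_cst.
by apply: (Ck_in_opp openW); apply: (Ck_in_mul openW); exact: CN.
Qed.

Lemma Ck_in_td_coef i k : Ck_in 2 W (td_coef i k).
Proof.
apply: (Ck_in_sum openW) => m; apply: (Ck_in_mul openW); [exact: Ck_in_tangent_proj|exact: CL].
Qed.

Lemma Ck_in_td k i F : (k <= 2)%N -> Ck_in k.+1 W F -> Ck_in k W (td i F).
Proof.
move=> k2 CF; apply: (@Ck_in_eq _ _ _ openW _ _ (fun q => \sum_k td_coef i k q * 'D_(label_dir k)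
    F q)).
  by move=> q Wq; rewrite tdE//; exact: differentiable_chart Wq CF.
apply: (Ck_in_sum openW) => j; apply: (Ck_in_mul openW).
  exact: Ck_in_le k2 (Ck_in_td_coef i j).
exact: Ck_in_derive.
Qed.

Lemma derive_eq_chart (F G : E -> R) q v : W q -> (forall q, W q -> F q = G q) ->
  'D_v F q = 'D_v G q.
Proof. by move=> Wq FG; apply: near_eq_derive; exact: open_near_in openW _ _ Wq FG. Qed.

(** A vector field on the labels is determined by its values on the ambient
    coordinates. *)
Lemma first_order_in_coordinates (c : 'I_n -> R) F q : W q ->
  \sum_l c l * 'D_(label_dir l) F q =
  \sum_m (\sum_l c l * 'D_(label_dir l) (X m) q) * ambient_d m F q.
Proof.
move=> Wq; rewrite /ambient_d.
transitivity (\sum_l \sum_k c l * (\sum_m 'D_(label_dir l) (X m) q * L m k q) * 'D_(label_dir k)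
    F q).
  apply: eq_bigr => l _; rewrite (bigD1 l)//= XL// eqxx mulr1 big1 ?addr0// => k kl.
  by rewrite XL// eq_sym (negbTE kl) mulr0 mul0r.
under eq_bigr do under eq_bigr do rewrite mulr_sumr mulr_suml.
under [RHS]eq_bigr do rewrite mulr_suml.
rewrite [RHS]exchange_big; apply: eq_bigr => l _.
rewrite exchange_big; apply: eq_bigr => m _; rewrite mulr_sumr.
by apply: eq_bigr => k _; rewrite !mulrA.
Qed.

Lemma td_coordinates i m q : W q -> td i (X m) q = tangent_proj i m q.
Proof.
move=> Wq; rewrite td_ambient_d; last exact: differentiable_chart Wq (CX m).
rewrite (bigD1 m)//= /ambient_d LX// eqxx mulr1 big1 ?addr0// => k km.
by rewrite LX// (negbTE km) mulr0.
Qed.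

(** Expanding the tangential derivative separates the derivatives of its coefficients
    from second derivatives of [F], which cancel in commutators. *)
Lemma derive_td v i F q : W q -> Ck_in 2 W F ->
  'D_v (td i F) q = \sum_l ('D_v (td_coef i l) q * 'D_(label_dir l) F q +
     td_coef i l q * 'D_v ('D_(label_dir l) F) q).
Proof.
move=> Wq CF.
have dt l : differentiable (td_coef i l) q by exact: differentiable_chart Wq (Ck_in_td_coef i l).
have dF l : differentiable ('D_(label_dir l) F) q by exact: differentiable_chart Wq (Ck_in_derive
    _ CF).
rewrite (derive_eq_chart v Wq (G := fun q => \sum_l td_coef i l q * 'D_(label_dir l) F q)); last
    first.
  by move=> z Wz; rewrite tdE//; exact: differentiable_chart Wz CF.
rewrite derive_sumf; last by move=> l; apply: differentiableM; [exact: dt|exact: dF].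
by apply: eq_bigr => l _; rewrite derive_mulf; [|exact: dt|exact: dF].
Qed.

(** The commutator is again a first-order operator: second derivatives of [F] cancel
    by symmetry. *)
Lemma commutator_coef i j F q : W q -> Ck_in 2 W F ->
  td i (td j F) q - td j (td i F) q =
  \sum_l (td i (td_coef j l) q - td j (td_coef i l) q) * 'D_(label_dir l) F q.
Proof.
move=> Wq CF.
have H a b : td a (td b F) q = \sum_l td a (td_coef b l) q * 'D_(label_dir l) F q +
   \sum_l \sum_k td_coef a k q * td_coef b l q * 'D_(label_dir k) ('D_(label_dir l) F) q.
  have -> : td a (td b F) q = 'D_(td_dir a q) (td b F) q by [].
  rewrite (derive_td _ _ Wq CF) big_split; congr (_ + _).
  apply: eq_bigr => l _.
  have dF : differentiable ('D_(label_dir l) F) q by exact: differentiable_chart Wq (Ck_in_derive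
      _ CF).
  have -> : 'D_(td_dir a q) ('D_(label_dir l) F) q = td a ('D_(label_dir l) F) q by [].
  rewrite (tdE _ dF) mulr_sumr; apply: eq_bigr => k _.
  by rewrite mulrA; congr (_ * _); exact: mulrC.
rewrite !H.
have -> : \sum_l \sum_k td_coef j k q * td_coef i l q * 'D_(label_dir k) ('D_(label_dir l) F) q
  = \sum_l \sum_k td_coef i k q * td_coef j l q * 'D_(label_dir k) ('D_(label_dir l) F) q.
  rewrite exchange_big; apply: eq_bigr => l _; apply: eq_bigr => k _.
  by rewrite (derive_swap _ _ openW Wq CF) [td_coef j l q * _]mulrC.
rewrite opprD addrACA subrr addr0 -sumrB.
by apply: eq_bigr => l _; rewrite mulrBl.
Qed.

Lemma time_commutator_coef i F q : W q -> Ck_in 2 W F ->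
  'D_time_dir (td i F) q - td i ('D_time_dir F) q =
  \sum_l 'D_time_dir (td_coef i l) q * 'D_(label_dir l) F q.
Proof.
move=> Wq CF; rewrite (derive_td _ _ Wq CF) big_split/=.
have dF : differentiable ('D_time_dir F) q by exact: differentiable_chart Wq (Ck_in_derive _ CF).
rewrite (tdE _ dF).
under [X in _ + X - _]eq_bigr do rewrite (derive_swap _ _ openW Wq CF).
by rewrite addrK.
Qed.

Lemma CX2 m : Ck_in 2 W (X m). Proof. exact: Ck_in_le (CX m). Qed.

(** The coefficients of the commutator in the coordinates [X] are its values on [X],
    and these are known because [td i (X m)] is the projection matrix. *)
Lemma commutator_ambient_d i j F q : W q -> Ck_in 2 W F ->
  td i (td j F) q - td j (td i F) q =
  \sum_m (td i (tangent_proj j m) q - td j (tangent_proj i m) q) * ambient_d m F q.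
Proof.
move=> Wq CF; rewrite (commutator_coef _ _ Wq CF) (first_order_in_coordinates _ _ Wq).
apply: eq_bigr => m _; rewrite -(commutator_coef _ _ Wq (CX2 m)).
by congr ((_ - _) * _); apply: (derive_eq_chart _ Wq) => z Wz; exact: td_coordinates.
Qed.

Lemma time_commutator_ambient_d i F q : W q -> Ck_in 2 W F ->
  'D_time_dir (td i F) q - td i ('D_time_dir F) q =
  \sum_m ('D_time_dir (tangent_proj i m) q - td i ('D_time_dir (X m)) q) * ambient_d m F q.
Proof.
move=> Wq CF; rewrite (time_commutator_coef _ Wq CF) (first_order_in_coordinates _ _ Wq).
apply: eq_bigr => m _; rewrite -(time_commutator_coef _ Wq (CX2 m)).
by congr ((_ - _) * _); apply: (derive_eq_chart _ Wq) => z Wz; exact: td_coordinates.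
Qed.

End adapted_chart.

(** * Geometry of the moving level sets *)

Lemma sum_delta (R : realType) n (m : 'I_n) (f : 'I_n -> R) :
  \sum_k (m == k)%:R * f k = f m.
Proof.
rewrite (bigD1 m)//= eqxx mul1r big1 ?addr0// => k km.
by rewrite eq_sym (negbTE km) mul0r.
Qed.

Section contractions.
Variables (R : realType) (n : nat) (N ai aj f : 'I_n -> R).
Hypothesis aiN : \sum_m ai m * N m = 0.
Hypothesis ajN : \sum_m aj m * N m = 0.

(** The commutator coefficients are built from N and from vectors a_i orthogonal to
    N (rows of the shape operator, d_t N, the gradient of the velocity).  Contracting
    them with a multiple of N keeps only the components along N, and contracting
    them with f + c N loses c; the next four lemmas are these contractions. *)
Lemma contract_normal (Ni Nj aij aji c : R) : \sum_m N m * N m = 1 ->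
  \sum_m (- (aij * N m + Nj * ai m) - - (aji * N m + Ni * aj m)) * (c * N m)
  = c * (aji - aij).
Proof.
move=> NN.
transitivity (c * ((aji - aij) * (\sum_m N m * N m) + Ni * (\sum_m aj m * N m)
   - Nj * (\sum_m ai m * N m))); last by rewrite NN ajN aiN; ring.
rewrite !mulr_sumr -big_split -sumrB mulr_sumr; apply: eq_bigr => m _ /=; ring.
Qed.

Lemma contract_tangent (Ni Nj a c : R) :
  \sum_m (- (a * N m + Nj * ai m) - - (a * N m + Ni * aj m)) * (f m + N m * c)
  = Ni * (\sum_m aj m * f m) - Nj * (\sum_m ai m * f m).
Proof.
transitivity (Ni * (\sum_m aj m * f m) - Nj * (\sum_m ai m * f m)
   + (Ni * c * (\sum_m aj m * N m) - Nj * c * (\sum_m ai m * N m))).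
  rewrite !mulr_sumr -!sumrB -big_split; apply: eq_bigr => m _ /=; ring.
by rewrite aiN ajN; ring.
Qed.

Lemma contract_time_normal (Ni p dv vel c : R) : \sum_m N m * N m = 1 ->
  \sum_m (- (p * N m + Ni * aj m) - (dv * N m + vel * ai m)) * (c * N m)
  = c * (- p - dv).
Proof.
move=> NN.
transitivity (c * ((- p - dv) * (\sum_m N m * N m) - Ni * (\sum_m aj m * N m)
   - vel * (\sum_m ai m * N m))); last by rewrite NN ajN aiN; ring.
rewrite !mulr_sumr -!sumrB mulr_sumr; apply: eq_bigr => m _ /=; ring.
Qed.

Lemma contract_time_tangent (Ni dv vel c : R) :
  \sum_m (- (- dv * N m + Ni * - aj m) - (dv * N m + vel * ai m)) * (f m + N m * c)
  = Ni * (\sum_m aj m * f m) - vel * (\sum_m ai m * f m).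
Proof.
transitivity (Ni * (\sum_m aj m * f m) - vel * (\sum_m ai m * f m)
   + (Ni * c * (\sum_m aj m * N m) - vel * c * (\sum_m ai m * N m))).
  rewrite !mulr_sumr -!sumrB -big_split; apply: eq_bigr => m _ /=; ring.
by rewrite aiN ajN; ring.
Qed.

End contractions.

Section chart_geometry.
Variables (R : realType) (n : nat).
Notation E := ('cV[R]_n * R)%type.
Variables (W : set E) (X N : 'I_n -> E -> R).
Variables (L : 'I_n -> 'I_n -> E -> R) (phi r : E -> R).
Hypothesis chart : adapted_chart W X N L phi r.
Implicit Types (F : E -> R) (q : E).
Let CN := chart_CN chart.
Notation td := (td N L).
Notation ambient_d := (ambient_d L).

Notation A i j q := (td i (N j) q).

Definition normal_d F q := \sum_k N k q * ambient_d k F q.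

Lemma ambient_d_split m F q : differentiable F q ->
  ambient_d m F q = td m F q + N m q * normal_d F q.
Proof.
move=> dF; rewrite (td_ambient_d _ _ _ dF) /normal_d mulr_sumr -big_split/=.
rewrite -[LHS](sum_delta m (fun k => ambient_d k F q)); apply: eq_bigr => k _.
by rewrite /tangent_proj; ring.
Qed.

Lemma differentiable_normal j q : W q -> differentiable (N j) q.
Proof. by move=> Wq; exact: differentiable_chart Wq (CN j). Qed.

(** Differentiate |N|^2 = 1. *)
Lemma derive_normal_orth v q : W q -> \sum_j 'D_v (N j) q * N j q = 0.
Proof.
move=> Wq.
have : 'D_v (fun q => \sum_j N j q * N j q) q = 0.
  rewrite (derive_eq_chart chart v Wq (G := fun=> 1)); last exact: chart_N1 chart.
  exact: derive_cst.
rewrite derive_sumf; last by move=> i; apply: differentiableM; exact: differentiable_normal.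
have -> : \sum_i 'D_v (fun x : E => N i x * N i x) q = 2 * \sum_j 'D_v (N j) q * N j q.
  rewrite mulr_sumr; apply: eq_bigr => i _.
  by rewrite derive_mulf; [ring|exact: differentiable_normal|exact: differentiable_normal].
by move=> /eqP; rewrite mulf_eq0 pnatr_eq0/= => /eqP.
Qed.

Lemma derive_proj v j m q : W q ->
  'D_v (tangent_proj N j m) q = - ('D_v (N j) q * N m q + N j q * 'D_v (N m) q).
Proof.
move=> Wq; have dj := differentiable_normal j Wq; have dm := differentiable_normal m Wq.
have dp : differentiable (fun q => N j q * N m q) q by exact: differentiableM.
rewrite derive_addf; [|exact: differentiable_cst|exact: differentiableN].
by rewrite derive_oppf// derive_mulf// derive_cst add0r.
Qed.

(** The gradient of [phi] is normal, so its tangential projection vanishes; this holds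
    on the whole chart and can be differentiated. *)
Lemma td_phi j q : W q -> td j phi q = 0.
Proof.
move=> Wq; rewrite (td_ambient_d _ _ _ (differentiable_chart Wq (chart_Cphi chart))).
under eq_bigr do rewrite /ambient_d (chart_Lphi chart Wq).
rewrite /tangent_proj.
have -> : \sum_m ((j == m)%:R - N j q * N m q) * (r q * N m q)
   = \sum_m ((j == m)%:R * (r q * N m q) - N j q * r q * (N m q * N m q)).
  by apply: eq_bigr => m _; ring.
rewrite sumrB sum_delta -mulr_sumr (chart_N1 chart Wq); ring.
Qed.

Lemma ambient_d_phi j q : W q -> ambient_d j phi q = r q * N j q.
Proof. by move=> Wq; rewrite -(chart_Lphi chart Wq). Qed.

(** All tangential derivatives of [phi] vanish, hence so does their commutator at
    [phi].  The gradient of [phi] is r N, and contracting the coefficients with it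
    leaves r (A_ji - A_ij). *)
Lemma shape_symmetric i j q : W q -> A i j q = A j i q.
Proof.
move=> Wq; have := commutator_ambient_d chart i j Wq (chart_Cphi chart).
have z v k : 'D_v (td k phi) q = 0.
  rewrite (derive_eq_chart chart v Wq (G := fun=> 0)); last by move=> z; exact: td_phi.
  exact: derive_cst.
have z' k l : td k (td l phi) q = 0 by exact: z.
rewrite !z' subrr => e.
have e2 : 0 = r q * (A j i q - A i j q).
  rewrite e.
  have H a b m : td a (tangent_proj N b m) q = - (A a b q * N m q + N b q * A a m q).
    exact: derive_proj.
  have an a : \sum_m A a m q * N m q = 0 by exact: derive_normal_orth.
  rewrite -(contract_normal (an i) (an j) (N i q) (N j q) _ _ _ (chart_N1 chart Wq)).
  by apply: eq_bigr => m _; rewrite !H (ambient_d_phi _ Wq).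
move/esym/eqP: e2; rewrite mulf_eq0 (negbTE (chart_r0 chart Wq))/= subr_eq0.
by move/eqP.
Qed.

(** The normal component of the gradient of [F] drops out because A N = 0 and A is
    symmetric. *)
Lemma commutator_td i j F q : W q -> Ck_in 2 W F ->
  td i (td j F) q - td j (td i F) q =
  N i q * (\sum_m A j m q * td m F q) - N j q * (\sum_m A i m q * td m F q).
Proof.
move=> Wq CF; rewrite (commutator_ambient_d chart i j Wq CF).
have H a b m : td a (tangent_proj N b m) q = - (A a b q * N m q + N b q * A a m q).
  exact: derive_proj.
have dF : differentiable F q by exact: differentiable_chart Wq CF.
have an a : \sum_m A a m q * N m q = 0 by exact: derive_normal_orth.
rewrite -(contract_tangent _ (an i) (an j) (N i q) (N j q) (A j i q) (normal_d F q)).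
by apply: eq_bigr => m _; rewrite !H (ambient_d_split _ dF) (shape_symmetric i j Wq).
Qed.

Section time.
Variables (Vel : E -> R) (q : E).
Hypothesis Wq : W q.
(* The tangential derivative of d_t X = Vel N, an equation which is only known on the
   surface itself. *)
Hypothesis velocity : forall i m, td i ('D_(time_dir R n) (X m)) q = td i Vel q * N m q + Vel q *
    A i m q.
Notation pt F := ('D_(time_dir R n) F).

(** The time commutator at [phi], which neither operator sees, contracts to
    r (- d_t N_i - td_i V). *)
Lemma time_derive_normal i : pt (N i) q = - td i Vel q.
Proof.
have := time_commutator_ambient_d chart i Wq (chart_Cphi chart).
have -> : pt (td i phi) q = 0.
  rewrite (derive_eq_chart chart _ Wq (G := fun=> 0)); last by move=> z; exact: td_phi.
  exact: derive_cst.
have -> : td i (pt phi) q = 0.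
  have -> : td i (pt phi) q = 'D_(td_dir N L i q) (pt phi) q by [].
  rewrite (derive_eq_chart chart _ Wq (G := fun=> 0)); last exact: chart_phit chart.
  exact: derive_cst.
rewrite subrr.
have an a : \sum_m A a m q * N m q = 0 by exact: derive_normal_orth.
have at0 := derive_normal_orth (time_dir R n) Wq.
have -> : \sum_m (pt (tangent_proj N i m) q - td i (pt (X m)) q) * ambient_d m phi q =
    r q * (- pt (N i) q - td i Vel q).
  rewrite -(contract_time_normal (an i) at0 (N i q) _ _ (Vel q) _ (chart_N1 chart Wq)).
  by apply: eq_bigr => m _; rewrite (derive_proj _ _ _ Wq) velocity (ambient_d_phi _ Wq).
move=> /esym/eqP; rewrite mulf_eq0 (negbTE (chart_r0 chart Wq)).
by rewrite /= subr_eq0 eqr_oppLR => /eqP.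
Qed.

Lemma time_commutator_td i F : Ck_in 2 W F ->
  pt (td i F) q = td i (pt F) q - Vel q * (\sum_m A i m q * td m F q)
     + N i q * (\sum_m td m Vel q * td m F q).
Proof.
move=> CF.
have dF : differentiable F q by exact: differentiable_chart Wq CF.
apply/eqP; rewrite -addrA addrC -subr_eq; apply/eqP.
rewrite (time_commutator_ambient_d chart i Wq CF).
have an a : \sum_m A a m q * N m q = 0 by exact: derive_normal_orth.
have at0 := derive_normal_orth (time_dir R n) Wq.
have vn : \sum_m td m Vel q * N m q = 0.
  transitivity (- \sum_m pt (N m) q * N m q); last by rewrite at0 oppr0.
  rewrite -sumrN; apply: eq_bigr => m _.
  by rewrite time_derive_normal; ring.
rewrite [RHS]addrC.
rewrite -(contract_time_tangent _ (an i) vn (N i q) (td i Vel q) (Vel q) (normal_d F q)).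
apply: eq_bigr => m _.
by rewrite (derive_proj _ _ _ Wq) velocity !time_derive_normal (ambient_d_split _ dF).
Qed.

End time.

End chart_geometry.

(** * The evolution equations in label coordinates *)

Section homogeneous.
Variables (R : realType) (n : nat) (gamma : 'cV[R]_n.+1 -> R).
Hypothesis gammaC : Ck_in 2 [set z | z != 0] gamma.
Hypothesis hom : forall (l : R) z, 0 < l -> gamma (l *: z) = l * gamma z.

Implicit Types z : 'cV[R]_n.+1.

Lemma open_neq0 : open [set z : 'cV[R]_n.+1 | z != 0].
Proof.
have -> : [set z : 'cV[R]_n.+1 | z != 0] = ~` [set 0].
  by apply/seteqP; split => z /=; [move/eqP|move=> z0; apply/eqP].
exact/closed_openC/accessible_closed_set1/hausdorff_accessible/norm_hausdorff.
Qed.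

(** Euler's identity: differentiate gamma (z + s z) = (1 + s) gamma z at s = 0. *)
Lemma euler_first z : z != 0 -> \sum_i z i 0 * 'D_(delta_mx i 0) gamma z = gamma z.
Proof.
move=> z0; have dg : differentiable gamma z by exact: (Ck_in_differentiable _ gammaC z0).
have -> : \sum_i z i 0 * 'D_(delta_mx i 0) gamma z = 'D_z gamma z.
  by rewrite -[RHS]/(derive gamma z z) [X in derive gamma z X](col_sum_delta z)
      derive_direction_sum.
have l0 : z + 0 *: z = z by rewrite scale0r addr0.
have dl := is_derive_line z z 0.
have d2 : is_derive (0 : R) 1 (gamma \o (fun s : R => z + s *: z)) ('D_z gamma z).
  by have := is_derive_curve (f := gamma) dl; rewrite l0; apply.
have d3 : is_derive (0 : R) 1 (fun s : R => gamma z + s *: gamma z) (gamma z).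
  exact: is_derive_line.
have [_ <-] := d2; have [_ <-] := d3.
apply: near_eq_derive.
have near1 : \forall s \near (0 : R), `|s| < 1 by exact: nbhs0_lt.
apply: filterS near1 => s s1; rewrite /= -{1}[z]scale1r -scalerDl hom.
  by rewrite mulrDl mul1r.
by move: s1; rewrite ltr_norml; lra.
Qed.

(** Differentiating Euler's identity gives z^T gamma''(z) = 0. *)
Lemma euler_second z j : z != 0 ->
  \sum_i z i 0 * 'D_(delta_mx j 0) ('D_(delta_mx i 0) gamma) z = 0.
Proof.
move=> z0.
have dg i : differentiable ('D_(delta_mx i 0) gamma) z.
  exact: (Ck_in_differentiable _ (Ck_in_derive _ gammaC) z0).
have dz i : differentiable (fun y : 'cV[R]_n.+1 => y i 0) z by exact: differentiable_coord.
have e : 'D_(delta_mx j 0) (fun y : 'cV[R]_n.+1 => \sum_i y i 0 * 'D_(delta_mx i 0) gamma y) z =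
    'D_(delta_mx j 0) gamma z.
  apply: near_eq_derive; apply: (open_near_in open_neq0 z0); exact: euler_first.
move: e; rewrite derive_sumf; last first.
  by move=> i; apply: differentiableM; [exact: dz|exact: dg].
under eq_bigr => i _ do rewrite (derive_mulf _ (dz i) (dg i)).
rewrite big_split.
have -> : \sum_i 'D_(delta_mx j 0) (fun y : 'cV[R]_n.+1 => y i 0) z * 'D_(delta_mx i 0) gamma z
  = 'D_(delta_mx j 0) gamma z.
  rewrite -[RHS](sum_delta j (fun i => 'D_(delta_mx i 0) gamma z)).
  apply: eq_bigr => i _; congr (_ * _).
  rewrite (derive_entry (f := id)); last exact: ex_diff.
  by rewrite derive_id mxE eqxx andbT eq_sym.
by rewrite -[RHS]addr0 => /addrI.
Qed.

End homogeneous.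

Section evolution.
Variables (R : realType) (d : nat).
Local Notation n := d.+1.
Notation E := ('cV[R]_n * R)%type.
Implicit Types (q z : E).
Variables (W : set E) (X N : 'I_n -> E -> R).
Variables (L : 'I_n -> 'I_n -> E -> R) (phi r : E -> R).
Hypothesis chart : adapted_chart W X N L phi r.
Let openW := chart_open chart.
Let CN := chart_CN chart.
Notation td := (td N L).
Notation A i j q := (td i (N j) q).
Notation pt F := ('D_(time_dir R n) F).
Variables (S : set E) (gamma beta : 'cV[R]_n -> R) (Vel : E -> R).
Hypothesis gammaC : Ck_in 4 [set z : 'cV[R]_n | z != 0] gamma.
Hypothesis hom : forall (l : R) (z : 'cV[R]_n), 0 < l -> gamma (l *: z) = l * gamma z.
Hypothesis betaC : Ck_in 2 setT beta.
Hypothesis VelC : Ck_in 2 W Vel.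
(* [S] stands for the surface: differentiating along it only needs values on it. *)
Hypothesis td_local : forall i (F G : E -> R) q, W q -> S q ->
  differentiable F q -> differentiable G q ->
  (forall z, W z -> S z -> F z = G z) -> td i F q = td i G q.
Hypothesis pt_local : forall (F G : E -> R) q, W q -> S q ->
  differentiable F q -> differentiable G q ->
  (forall z, W z -> S z -> F z = G z) -> pt F q = pt G q.

Definition normal_col (q : E) : 'cV[R]_n := \col_i N i q.
(** Components of the Cahn-Hoffman vector gamma'(N). *)
Definition cahn_hoffman i (q : E) : R := 'D_(delta_mx i 0) gamma (normal_col q).
Definition hess_normal i k (q : E) : R := 'D_(delta_mx k 0) ('D_(delta_mx i 0) gamma) (normal_col
    q).
Definition aniso_div q : R := \sum_i td i (cahn_hoffman i) q.
Definition shape_norm2 q : R := \sum_i \sum_m A i m q * \sum_k hess_normal i k q * A k m q.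

Hypothesis normal_velocity : forall q m, W q -> S q -> pt (X m) q = Vel q * N m q.
Hypothesis curvature_law : forall q, W q -> S q -> beta (normal_col q) * Vel q = - aniso_div q.

Lemma normal_col_neq0 q : W q -> normal_col q != 0.
Proof.
move=> Wq; apply/eqP => N0; have := chart_N1 chart Wq.
rewrite big1 => [|i _]; first by move/eqP; rewrite eq_sym oner_eq0.
by have /matrixP/(_ i 0) := N0; rewrite !mxE => ->; rewrite mul0r.
Qed.

Lemma normal_colE i q : normal_col q i 0 = N i q.
Proof. by rewrite mxE. Qed.

Lemma Ck_in_normal_col i : Ck_in 2 W (fun q => normal_col q i 0).
Proof. by apply: (Ck_in_eq openW _ (CN i)) => q _; rewrite mxE. Qed.

Lemma Ck_in_cahn_hoffman i : Ck_in 2 W (cahn_hoffman i).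
Proof.
apply: (Ck_in_comp openW (W := [set z : 'cV[R]_n | z != 0]) (f := 'D_(delta_mx i 0) gamma) (g :=
    normal_col)).
- by move=> q; exact: normal_col_neq0.
- by apply: (Ck_in_le (k := 3)); [|exact: Ck_in_derive].
- exact: Ck_in_normal_col.
Qed.

Lemma Ck_in_hess_normal i k : Ck_in 2 W (hess_normal i k).
Proof.
apply: (Ck_in_comp openW (W := [set z : 'cV[R]_n | z != 0]) (f := 'D_(delta_mx k 0) ('D_(delta_mx
    i 0) gamma)) (g := normal_col)).
- by move=> q; exact: normal_col_neq0.
- by apply: Ck_in_derive; exact: Ck_in_derive.
- exact: Ck_in_normal_col.
Qed.

Lemma Ck_in_beta_normal : Ck_in 2 W (fun q => beta (normal_col q)).
Proof.
by apply: (Ck_in_comp openW (W := setT) (f := beta) (g := normal_col)); [|exact: betaC|exact: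
    Ck_in_normal_col].
Qed.

Lemma differentiable_normal_col q i : W q -> differentiable (fun q => normal_col q i 0) q.
Proof. by move=> Wq; exact: differentiable_chart Wq (Ck_in_normal_col i). Qed.

Lemma derive_normal_col v q i : W q -> 'D_v (fun q => normal_col q i 0) q = 'D_v (N i) q.
Proof. by move=> Wq; apply: (derive_eq_chart chart _ Wq) => z _; rewrite mxE. Qed.

Lemma derive_cahn_hoffman v i q : W q -> 'D_v (cahn_hoffman i) q = \sum_k 'D_v (N k) q *
    hess_normal i k q.
Proof.
move=> Wq; rewrite (derive_comp_partials (f := 'D_(delta_mx i 0) gamma) (g := normal_col)).
- by apply: eq_bigr => k _; rewrite (derive_normal_col _ _ Wq).
- by move=> k; exact: differentiable_normal_col.
- exact: (Ck_in_differentiable _ (Ck_in_derive _ gammaC) (normal_col_neq0 Wq)).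
Qed.

Lemma derive_beta v q : W q ->
  'D_v (fun q => beta (normal_col q)) q = \sum_k 'D_v (N k) q * 'D_(delta_mx k 0) beta
      (normal_col q).
Proof.
move=> Wq; rewrite (derive_comp_partials (f := beta) (g := normal_col)).
- by apply: eq_bigr => k _; rewrite (derive_normal_col _ _ Wq).
- by move=> k; exact: differentiable_normal_col.
- exact: (Ck_in_differentiable _ betaC).
Qed.

(** The Hessian of [gamma] annihilates the normal, by Euler's identity. *)
Lemma derive_cahn_hoffman_orth v q : W q -> \sum_i N i q * 'D_v (cahn_hoffman i) q = 0.
Proof.
move=> Wq.
under eq_bigr do rewrite (derive_cahn_hoffman _ _ Wq) mulr_sumr.
rewrite exchange_big big1// => k _.
have gC2 : Ck_in 2 [set z : 'cV[R]_n | z != 0] gamma by exact: Ck_in_le gammaC.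
have e : \sum_i N i q * hess_normal i k q = 0.
  rewrite -[RHS](euler_second gC2 hom k (normal_col_neq0 Wq)).
  by apply: eq_bigr => i _; rewrite normal_colE.
transitivity ('D_v (N k) q * \sum_i N i q * hess_normal i k q); last by rewrite e mulr0.
rewrite mulr_sumr.
by apply: eq_bigr => i _; rewrite mulrCA.
Qed.

Lemma shape_norm2E q : W q -> \sum_i \sum_m A i m q * td m (cahn_hoffman i) q = shape_norm2 q.
Proof.
move=> Wq; apply: eq_bigr => i _; apply: eq_bigr => m _; congr (_ * _).
rewrite (_ : td m (cahn_hoffman i) q = 'D_(td_dir N L m q) (cahn_hoffman i) q)//
    (derive_cahn_hoffman _ _ Wq).
by apply: eq_bigr => k _; rewrite mulrC (shape_symmetric chart k m Wq).
Qed.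

Lemma Ck_in_td_cahn_hoffman i j : Ck_in 1 W (td j (cahn_hoffman i)).
Proof. by apply: (Ck_in_td chart (k := 1)); [exact: isT|exact: Ck_in_cahn_hoffman]. Qed.

Lemma Ck_in_td_velocity k : Ck_in 1 W (td k Vel).
Proof. by apply: (Ck_in_td chart (k := 1)); [exact: isT|exact: VelC]. Qed.

Lemma Ck_in_aniso_div : Ck_in 1 W aniso_div.
Proof.
by apply: (Ck_in_sum openW) => i; exact: Ck_in_td_cahn_hoffman.
Qed.

Lemma contract_cahn_hoffman v q (a : 'I_n -> R) : W q ->
  \sum_i N i q * (\sum_m a m * 'D_(v m) (cahn_hoffman i) q) = 0.
Proof.
move=> Wq; under eq_bigr do rewrite mulr_sumr.
rewrite exchange_big big1// => m _.
transitivity (a m * \sum_i N i q * 'D_(v m) (cahn_hoffman i) q).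
  rewrite mulr_sumr; apply: eq_bigr => i _; exact: mulrCA.
by rewrite (derive_cahn_hoffman_orth (v m) Wq) mulr0.
Qed.

(** By symmetry of the shape operator the entry (i, j) of gamma'' A is the derivative
    td_j of the i-th component of gamma'(N).  Exchanging td_i with td_j turns the
    divergence into a gradient; of the two curvature terms of the commutator, the one
    with the factor N_i vanishes by orthogonality and the other is |A|^2 N_j. *)
Lemma div_hess_shape j q : W q ->
  \sum_i td i (fun z => \sum_k hess_normal i k z * td k (N j) z) q =
  td j aniso_div q - shape_norm2 q * N j q.
Proof.
move=> Wq.
have e i : td i (fun z => \sum_k hess_normal i k z * td k (N j) z) q = td i (td j (cahn_hoffman
    i)) q.
  apply: (derive_eq_chart chart _ Wq) => z Wz.
  rewrite (_ : td j (cahn_hoffman i) z = 'D_(td_dir N L j z) (cahn_hoffman i) z)//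
      (derive_cahn_hoffman _ _ Wz).
  by apply: eq_bigr => k _; rewrite (shape_symmetric chart k j Wz) mulrC.
have c i : td i (td j (cahn_hoffman i)) q = td j (td i (cahn_hoffman i)) q +
   (N i q * (\sum_m A j m q * td m (cahn_hoffman i) q) - N j q * (\sum_m A i m q * td m
       (cahn_hoffman i) q)).
  by rewrite -(commutator_td chart i j Wq (Ck_in_cahn_hoffman i)) addrC subrK.
transitivity (\sum_i td j (td i (cahn_hoffman i)) q +
   (\sum_i N i q * (\sum_m A j m q * td m (cahn_hoffman i) q)
    - N j q * \sum_i \sum_m A i m q * td m (cahn_hoffman i) q)).
  rewrite mulr_sumr -sumrB -big_split; apply: eq_bigr => i _; rewrite e; exact: c.
rewrite (shape_norm2E Wq) (contract_cahn_hoffman _ _ Wq) sub0r [N j q * _]mulrC.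
congr (_ - _); rewrite -[RHS]/('D_(td_dir N L j q) aniso_div q) /aniso_div derive_sumf//.
by move=> i; exact: differentiable_chart Wq (Ck_in_td_cahn_hoffman i i).
Qed.

Section at_point.
Variable q : E.
Hypotheses (Wq : W q) (Sq : S q).

Lemma velocity_td z : W z -> S z -> forall i m,
  td i (pt (X m)) z = td i Vel z * N m z + Vel z * A i m z.
Proof.
move=> Wz Sz i m; have dV : differentiable Vel z by exact: differentiable_chart Wz VelC.
have dm : differentiable (N m) z by exact: differentiable_chart Wz (CN m).
have dX : differentiable (pt (X m)) z by exact: differentiable_chart Wz (Ck_in_derive _ (chart_CX
    chart m)).
rewrite (td_local i Wz Sz dX (G := fun z => Vel z * N m z)).
- exact: derive_mulf.
- exact: differentiableM.
- by move=> y Wy Sy; exact: normal_velocity.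
Qed.

Lemma derive_betaV v : 'D_v (fun z => beta (normal_col z) * Vel z) q =
  (\sum_k 'D_v (N k) q * 'D_(delta_mx k 0) beta (normal_col q)) * Vel q + beta (normal_col q) *
      'D_v Vel q.
Proof.
by rewrite derive_mulf; [rewrite (derive_beta _ Wq)|exact: differentiable_chart Wq
    Ck_in_beta_normal|exact: differentiable_chart Wq VelC].
Qed.

Let dcurv : differentiable aniso_div q. Proof. exact: differentiable_chart Wq Ck_in_aniso_div. Qed.
Let dbetaV : differentiable (fun z => - (beta (normal_col z) * Vel z)) q.
Proof.
apply: differentiableN; apply: differentiableM; [exact: differentiable_chart Wq
    Ck_in_beta_normal|exact: differentiable_chart Wq VelC].
Qed.
Let law z : W z -> S z -> aniso_div z = - (beta (normal_col z) * Vel z).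
Proof. by move=> Wz Sz; rewrite (curvature_law Wz Sz) opprK. Qed.
Let dbV : differentiable (fun z => beta (normal_col z) * Vel z) q.
Proof. apply: differentiableM; [exact: differentiable_chart Wq Ck_in_beta_normal|exact:
    differentiable_chart Wq VelC]. Qed.

(** The tangential gradient of the law beta(N) V = - H_gamma. *)
Lemma normal_evolution j : beta (normal_col q) * pt (N j) q =
  \sum_i td i (fun z => \sum_k hess_normal i k z * td k (N j) z) q + shape_norm2 q * N j q
  + Vel q * \sum_k A j k q * 'D_(delta_mx k 0) beta (normal_col q).
Proof.
rewrite (div_hess_shape j Wq) subrK (td_local j Wq Sq dcurv dbetaV law).
have -> : td j (fun z => - (beta (normal_col z) * Vel z)) q = - 'D_(td_dir N L j q) (fun z =>
    beta (normal_col z) * Vel z) q.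
  exact: derive_oppf.
rewrite derive_betaV (time_derive_normal chart Wq (velocity_td Wq Sq)).
by rewrite opprD mulrN [X in - X - _]mulrC addrAC addNr add0r.
Qed.

(** The time derivative of the law beta(N) V = - H_gamma. *)
Lemma velocity_evolution : beta (normal_col q) * pt Vel q =
  \sum_i td i (fun z => \sum_k hess_normal i k z * td k Vel z) q + shape_norm2 q * Vel q
  + Vel q * \sum_k td k Vel q * 'D_(delta_mx k 0) beta (normal_col q).
Proof.
have e1 : pt aniso_div q = - (pt (fun z => beta (normal_col z) * Vel z) q).
  by rewrite (pt_local Wq Sq dcurv dbetaV law) derive_oppf.
have dY i : differentiable (fun z => \sum_k hess_normal i k z * td k Vel z) q.
  apply: differentiable_sumf => k; apply: differentiableM; first exact: differentiable_chart Wq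
      (Ck_in_hess_normal i k).
  exact: differentiable_chart Wq (Ck_in_td_velocity k).
have e2 i : td i (pt (cahn_hoffman i)) q = - td i (fun z => \sum_k hess_normal i k z * td k Vel
    z) q.
  rewrite (td_local i Wq Sq (G := fun z => - \sum_k hess_normal i k z * td k Vel z)).
  - exact: derive_oppf.
  - exact: differentiable_chart Wq (Ck_in_derive _ (Ck_in_cahn_hoffman i)).
  - exact: differentiableN.
  - move=> z Wz Sz; rewrite (derive_cahn_hoffman _ _ Wz) -sumrN; apply: eq_bigr => k _.
    by rewrite (time_derive_normal chart Wz (velocity_td Wz Sz)) mulNr mulrC.
have e3 : pt aniso_div q = - (\sum_i td i (fun z => \sum_k hess_normal i k z * td k Vel z) q) -
    shape_norm2 q * Vel q.
  rewrite /aniso_div derive_sumf; last first.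
    by move=> i; exact: differentiable_chart Wq (Ck_in_td_cahn_hoffman i i).
  transitivity (\sum_i (- td i (fun z => \sum_k hess_normal i k z * td k Vel z) q)
     - Vel q * (\sum_i \sum_m A i m q * td m (cahn_hoffman i) q)
     + \sum_i N i q * (\sum_m td m Vel q * td m (cahn_hoffman i) q)).
    rewrite mulr_sumr -sumrB -big_split; apply: eq_bigr => i _.
    rewrite -e2; exact: (time_commutator_td chart Wq (velocity_td Wq Sq) i (Ck_in_cahn_hoffman i)).
  rewrite (shape_norm2E Wq) (contract_cahn_hoffman _ _ Wq) addr0 sumrN.
  by rewrite [shape_norm2 q * _]mulrC.
have e4 : \sum_k pt (N k) q * 'D_(delta_mx k 0) beta (normal_col q) =
    - \sum_k td k Vel q * 'D_(delta_mx k 0) beta (normal_col q).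
  rewrite -sumrN; apply: eq_bigr => k _.
  by rewrite (time_derive_normal chart Wq (velocity_td Wq Sq)) mulNr.
rewrite derive_betaV e3 e4 in e1.
have solve (y s v b bp : R) : - y - s * v = - (- b * v + bp) -> bp = y + s * v + v * b.
  move=> h; have -> : bp = - (- (- b * v + bp)) + b * v by ring.
  by rewrite -h; ring.
exact: solve e1.
Qed.

End at_point.
End evolution.

(** * Curves in a regular zero set *)

(** Replaces a smallest element, which need not exist, in the choice below. *)
Lemma exists_almost_smallest (R : realType) (A : set R) (e : R) :
  A !=set0 -> 0 < e -> exists2 a, A a & forall b, A b -> `|a| <= `|b| + e.
Proof.
move=> A0 e0; pose B := [set `|a| | a in A].
have infB : has_inf B.
  split; first by case: A0 => a Aa; exists `|a|; exists a.
  by exists 0 => _ [a _ <-].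
have [_ [a Aa <-] lt_a] := inf_adherent e0 infB.
exists a => // b Ab; rewrite (le_trans (ltW lt_a))// lerD2r.
by apply: (ge_inf infB.2); exists b.
Qed.

Section zero_set_curve.
Variables (R : realType) (V : normedModType R) (U : set V) (phi : V -> R).
Hypothesis openU : open U.
Hypothesis cphi : forall y, U y -> {for y, continuous phi}.
Variables (x w tau : V).
Hypothesis Ux : U x.
Hypothesis dphi : differentiable phi x.
Hypothesis phix : phi x = 0.
Hypothesis phiw : 'D_w phi x = 1.
Hypothesis phitau : 'D_tau phi x = 0.

Let pt s r := x + s *: tau + r *: w.

(** Along the transversal x + s tau + r w the function [phi] is r + o(|s| + |r|), so it
    changes sign between r = - eta |s| and r = eta |s|. *)
Lemma zero_near_tangent eta : 0 < eta -> \forall s \near (0 : R),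
  exists r, [/\ `|r| <= eta * `|s|, U (pt s r) & phi (pt s r) = 0].
Proof.
move=> eta0.
(* |s tau + r w| is at most C |s| when |r| is at most eta |s|. *)
pose C := `|tau| + eta * `|w| + 1.
have C0 : 0 < C by rewrite /C; have := normr_ge0 tau; have := normr_ge0 w; nra.
pose e := eta / (2 * C).
have e0 : 0 < e by rewrite divr_gt0// mulr_gt0.
have N1 : \forall h \near (0 : V), U (h + x).
  have : \forall y \near x, U y by exact: open_nbhs_nbhs.
  by rewrite (near_shift 0) subr0.
have N2 : \forall h \near (0 : V), `|phi (h + x) - 'd phi x h| <= e * `|h|.
  have /diff_locally/eqaddoP/(_ e e0) := dphi.
  apply: filterS => h.
  by rewrite !fctE /= phix opprD oppr0 add0r.
have [d /= d0 Nd] := (nbhs_ballP _ _).1 (filterI N1 N2).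
have Hs : \forall s \near (0 : R), `|s| < d / C by apply: nbhs0_lt; rewrite divr_gt0.
apply: filterS Hs => s sd.
have sC : `|s| * C < d by rewrite -ltr_pdivlMr.
have H r : `|r| <= eta * `|s| ->
    U (pt s r) /\ `|phi (pt s r) - r| <= e * (`|s| * C).
  move=> rs; pose h := s *: tau + r *: w.
  have hC : `|h| <= `|s| * C.
    apply: le_trans (ler_normD _ _) _; rewrite !normrZ /C.
    have := normr_ge0 tau; have := normr_ge0 w; have := normr_ge0 s; nra.
  have hd : ball (0 : V) d h.
    by rewrite -ball_normE /ball_/= sub0r normrN (le_lt_trans hC).
  have [Uh ph] := Nd _ hd.
  have E : h + x = pt s r by rewrite /pt /h addrC addrA.
  have D : 'd phi x h = r.
    by rewrite /h linearD !linearZ/= -!deriveE// phitau phiw /GRing.scale/= mulr0 add0r mulr1.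
  rewrite E D in Uh ph; split => //; apply: le_trans ph _.
  by rewrite ler_pM2l.
have eC : e * (`|s| * C) = eta * `|s| / 2.
  by rewrite /e; field; rewrite gt_eqF.
pose b := eta * `|s|; have b0 : 0 <= b by rewrite mulr_ge0// ltW.
have bb : - b <= b by rewrite -subr_ge0 opprK addr_ge0.
have inb r : r \in `[- b, b] -> `|r| <= eta * `|s| by rewrite in_itv/= ler_norml.
have [r rb r0] : exists2 r, r \in `[- b, b] & phi (pt s r) = 0.
  apply: (@IVT R (fun r => phi (pt s r)) _ _ 0 bb).
    apply: continuous_in_subspaceT => r; rewrite inE => rb.
    have [Ur _] := H r (inb _ rb).
    apply: (@continuous_comp _ _ _ (pt s) phi); last exact: cphi.
    apply: differentiable_continuous; apply/derivable1_diffP.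
    by apply: ex_derive; exact: is_derive_line.
  have nb : `|- b| <= eta * `|s| by rewrite normrN ger0_norm.
  have nb' : `|b| <= eta * `|s| by rewrite ger0_norm.
  have [_] := H _ nb; have [_] := H _ nb'; rewrite eC -/b !ler_norml.
  move=> /andP[h1 h2] /andP[h3 h4].
  have hm : phi (pt s (- b)) <= 0 by lra.
  have hp : 0 <= phi (pt s b) by lra.
  by rewrite ge_min le_max hm hp orbT.
exists r; have rs := inb _ rb; have [Ur _] := H _ rs; split => //.
Qed.

(** Every tangent direction of a regular zero set is the velocity of a curve in it.
    Only differentiability at the endpoint is asked of the curve, so the
    intermediate value theorem suffices: the offset r(s) along [w] is chosen smallest
    up to s^2, which makes it o(s). *)
Lemma zero_set_curve : exists c : R -> V,
  [/\ c 0 = x, \forall s \near (0 : R), U (c s) /\ phi (c s) = 0 &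
      is_derive (0 : R) 1 c tau].
Proof.
pose Z s := [set r | U (pt s r) /\ phi (pt s r) = 0].
have /choice[rho rhoP] : forall s, exists r, (s = 0 -> r = 0) /\
    (s != 0 -> Z s !=set0 -> Z s r /\ forall r', Z s r' -> `|r| <= `|r'| + s ^+ 2).
  move=> s.
  have [s0|s0] := eqVneq s 0; first by exists 0.
  have [Zs|Zs] := pselect (Z s !=set0); last by exists 0.
  have [|r Zr rmin] := @exists_almost_smallest R (Z s) (s ^+ 2) Zs.
    by rewrite exprn_even_gt0.
  by exists r; split => // e; rewrite e eqxx in s0.
have rho0 : rho 0 = 0 by exact: (rhoP 0).1.
have zero1 := zero_near_tangent ltr01.
have drho : is_derive (0 : R) 1 rho 0.
  have cv : (fun h => h^-1 *: ((rho \o shift (0 : R)) (h *: 1) - rho 0)) @ 0^' --> (0 : R).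
    apply/cvgr0Pnorm_le => e e0.
    have e2 : 0 < e / 2 by rewrite divr_gt0.
    have h1 := zero_near_tangent e2.
    have h2 : \forall s \near (0 : R), `|s| < e / 2 by exact: nbhs0_lt.
    rewrite near_withinE; apply: filterS2 h1 h2 => s [r [rs Ur r0]] se s0.
    rewrite rho0 subr0 /= addr0 /GRing.scale/= mulr1 normrM normfV.
    have [_ rmin] := (rhoP s).2 s0 (ex_intro _ r (conj Ur r0)).
    have ns : 0 < `|s| by rewrite normr_gt0.
    rewrite mulrC ler_pdivrMr//; apply: le_trans (rmin r (conj Ur r0)) _.
    rewrite -[s ^+ 2]real_normK ?num_real//; nra.
  split; first by apply/cvg_ex; exists 0.
  exact: cvg_lim cv.
exists (fun s => pt s (rho s)); split.
- by rewrite /pt rho0 !scale0r !addr0.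
- apply: filterS zero1 => s [r [_ Ur r0]].
  have [->|s0] := eqVneq s 0; first by rewrite /pt rho0 !scale0r !addr0.
  by have [+ _] := (rhoP s).2 s0 (ex_intro _ r (conj Ur r0)).
- rewrite /pt -[tau in is_derive _ _ _ tau]addr0; apply: is_deriveD.
    exact: is_derive_line.
  have dw : differentiable ( *:%R^~ w : R -> V) (rho 0) by exact: ex_diff.
  have := is_derive_curve drho dw.
  by rewrite derive0.
Qed.

End zero_set_curve.

(** * Local extensions of the flow map *)

Lemma is_derive_slice_curve (R : realType) (V : normedModType R) (c : R -> V)
    (s t : R) (tau : V) :
  is_derive s 1 c tau -> is_derive s 1 (fun s => (c s, t)) ((tau, 0) : V * R).
Proof.
move=> dc.
have dp : is_diff (c s) (fun y : V => (y, t)) (fun y : V => (y, 0)) by exact: is_diff_pair.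
have dd : differentiable (fun y : V => (y, t)) (c s) by exact: ex_diff.
have := is_derive_curve dc dd.
by rewrite deriveE// (diff_val (is_diff_def := dp)).
Qed.

Lemma is_derive_continuous (R : realType) (V : normedModType R) (c : R -> V) (s : R) tau :
  is_derive s 1 c tau -> {for s, continuous c}.
Proof.
move=> dc; apply: differentiable_continuous; apply/derivable1_diffP.
exact: ex_derive.
Qed.

Lemma derive_near_curve (R : realType) (V W : normedModType R) (F G : V -> W)
    (c : R -> V) (tau : V) :
  is_derive (0 : R) 1 c tau -> differentiable F (c 0) -> differentiable G (c 0) ->
  (\forall s \near (0 : R), F (c s) = G (c s)) -> 'D_tau F (c 0) = 'D_tau G (c 0).
Proof.
move=> dc dF dG FG.
have [_ <-] := is_derive_curve dc dF; have [_ <-] := is_derive_curve dc dG.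
exact: near_eq_derive.
Qed.

Section local_extension.
Variables (R : realType) (d : nat).
Local Notation n := d.+1.
Notation E := ('cV[R]_n * R)%type.
Variables (T : R) (G0 : set 'cV[R]_n) (X : 'cV[R]_n -> R -> 'cV[R]_n).

(** On [U], [Xh] extends the flow map off the initial surface, which is the zero set
    of [phi]; labels and times in [U] stay in the domain of the flow. *)
Record local_extension (U0 : set 'cV[R]_n) (phi : 'cV[R]_n -> R) (U : set E)
    (Xh : 'I_n -> E -> R) : Prop := LocalExtension {
  ext_open0 : open U0;
  ext_phi : Ck_in 3 U0 phi;
  ext_G0 : forall y, U0 y -> (G0 y <-> phi y = 0);
  ext_grad : forall y, U0 y -> G0 y -> grad phi y != 0;
  ext_open : open U;
  ext_sub : forall q, U q -> U0 q.1;
  ext_time : forall q, U q -> 0 < q.2 < T;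
  ext_CX : forall i, Ck_in 3 U (Xh i);
  ext_X : forall q i, U q -> G0 q.1 -> X q.1 q.2 i 0 = Xh i q
}.

Variables (U0 : set 'cV[R]_n) (phi : 'cV[R]_n -> R) (U : set E) (Xh : 'I_n -> E -> R).
Hypothesis ext : local_extension U0 phi U Xh.

Definition Xcol (q : E) : 'cV[R]_n := \col_i Xh i q.

Lemma XcolE q : U q -> G0 q.1 -> Xcol q = X q.1 q.2.
Proof.
by move=> Uq Gq; apply/colP => i; rewrite mxE (ext_X ext i Uq Gq).
Qed.

Lemma differentiable_Xcol q : U q -> differentiable Xcol q.
Proof.
move=> Uq; apply: differentiable_col => i.
apply: (near_eq_differentiable (f := Xh i)).
  by apply: filterE => y; rewrite mxE.
exact: (Ck_in_differentiable _ (ext_CX ext i) Uq).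
Qed.

Lemma derive_Xcol q v i : U q -> ('D_v Xcol q) i 0 = 'D_v (Xh i) q.
Proof.
move=> Uq; have <- := derive_entry v i 0 (differentiable_Xcol Uq).
have -> : (fun y => Xcol y i 0) = Xh i by apply/funext => y; rewrite mxE.
by [].
Qed.

Lemma differentiable_phi q : U q -> differentiable phi q.1.
Proof. by move=> Uq; exact: (Ck_in_differentiable _ (ext_phi ext) (ext_sub ext Uq)). Qed.

(** [zero_set_curve] for the initial surface; the transversal direction is a coordinate
    vector along which [phi] has a nonzero derivative, scaled to derivative 1. *)
Lemma surface_curve q tau : U q -> G0 q.1 -> 'D_tau phi q.1 = 0 ->
  exists c : R -> 'cV[R]_n, [/\ c 0 = q.1,
    \forall s \near (0 : R), G0 (c s) /\ U (c s, q.2) & is_derive (0 : R) 1 c tau].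
Proof.
move=> Uq Gq tan; have Uq0 := ext_sub ext Uq.
have [i gi] : exists i, 'D_(delta_mx i 0) phi q.1 != 0.
  apply/existsP; apply: contraNT (ext_grad ext Uq0 Gq).
  rewrite negb_exists => /forallP H; apply/eqP/colP => i.
  by rewrite !mxE; apply/eqP; have := H i; rewrite negbK.
pose w : 'cV[R]_n := ('D_(delta_mx i 0) phi q.1)^-1 *: delta_mx i 0.
have phiw : 'D_w phi q.1 = 1.
  rewrite deriveE; last exact: differentiable_phi.
  rewrite linearZ -deriveE; last exact: differentiable_phi.
  exact: (mulVf gi).
have cphi y : U0 y -> {for y, continuous phi}.
  by move=> Uy; exact: Ck_in_continuous (ext_phi ext) Uy.
have [c [c0 cU dc]] := zero_set_curve (ext_open0 ext) cphi Uq0 (differentiable_phi Uq)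
  (((ext_G0 ext Uq0).1) Gq) phiw tan.
exists c; split => //.
have cc := is_derive_continuous (is_derive_slice_curve q.2 dc).
have Un : \forall z \near (c 0, q.2), U z.
  by apply: open_nbhs_nbhs; split; [exact: ext_open ext|rewrite c0 -surjective_pairing].
have cU2 : \forall s \near (0 : R), U (c s, q.2) by exact: (cc _ Un).
by apply: filterS2 cU cU2 => s [U0s ps] Us; split => //; apply/(ext_G0 ext U0s).
Qed.

(** The flow maps curves in the initial surface to curves in the moving one. *)
Lemma tangent_Xcol q tau : U q -> G0 q.1 -> 'D_tau phi q.1 = 0 ->
  tangent_vector (surface G0 X q.2) (X q.1 q.2) ('D_(tau, 0) Xcol q).
Proof.
move=> Uq Gq tan; have [c [c0 cG dc]] := surface_curve Uq Gq tan.
have q0 : (c 0, q.2) = q by rewrite c0 -surjective_pairing.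
exists (fun s => Xcol (c s, q.2)); split.
- by rewrite q0 XcolE.
- apply: filterS cG => s [Gs Us]; exists (c s) => //.
  by rewrite XcolE.
- have dX : differentiable Xcol (c 0, q.2) by rewrite q0; exact: differentiable_Xcol.
  by have := is_derive_curve (is_derive_slice_curve q.2 dc) dX; rewrite q0.
Qed.

Lemma pt_local (F G : E -> R) q : U q -> G0 q.1 ->
  differentiable F q -> differentiable G q ->
  (forall z, U z -> G0 z.1 -> F z = G z) -> 'D_(time_dir R n) F q = 'D_(time_dir R n) G q.
Proof.
case: q => p t Uq Gq dF dG FG.
have [_ <-] := is_derive_time dF; have [_ <-] := is_derive_time dG.
apply: near_eq_derive.
have cc : {for t, continuous (fun s : R => (p, s))}.
  move=> A; apply: (cvg_pair (G := nbhs p) (H := nbhs t)); [exact: cvg_cst|exact: cvg_id].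
have Un : \forall z \near (p, t), U z.
  by apply: open_nbhs_nbhs; split; [exact: ext_open ext|].
have cU : \forall s \near t, U (p, s) by exact: (cc _ Un).
by apply: filterS cU => s Us; exact: FG.
Qed.

(** A derivative in a tangential label direction only sees values on the initial
    surface. *)
Lemma slice_local (F G : E -> R) q tau : U q -> G0 q.1 -> 'D_tau phi q.1 = 0 ->
  differentiable F q -> differentiable G q ->
  (forall z, U z -> G0 z.1 -> F z = G z) -> 'D_(tau, 0) F q = 'D_(tau, 0) G q.
Proof.
move=> Uq Gq tan dF dG FG; have [c [c0 cG dc]] := surface_curve Uq Gq tan.
have q0 : (c 0, q.2) = q by rewrite c0 -surjective_pairing.
rewrite -q0; apply: (derive_near_curve (is_derive_slice_curve q.2 dc)); rewrite ?q0//.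
by apply: filterS cG => s [Gs Us]; exact: FG.
Qed.

End local_extension.

(** * Charts from local extensions *)

Lemma open_neq0_in (R : realType) (V : normedModType R) (U : set V) (f : V -> R) :
  open U -> (forall q, U q -> {for q, continuous f}) ->
  open [set q | U q /\ f q != 0].
Proof.
move=> openU cf; rewrite openE => q [Uq fq]; rewrite /interior/=.
have h1 : \forall z \near q, U z by exact: open_nbhs_nbhs.
have h2 : \forall z \near q, f z != 0 by exact: cvgr_neq0 (cf q Uq) fq.
by apply: filterS2 h1 h2.
Qed.

Lemma Ck_in_det (R : realType) (V : normedModType R) (U : set V) k n
    (M : V -> 'M[R]_n) : open U ->
  (forall i j, Ck_in k U (fun q => M q i j)) -> Ck_in k U (fun q => \det (M q)).
Proof.
move=> openU CM; apply: (Ck_in_sum openU) => s.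
apply: (Ck_in_mul openU); first exact: Ck_in_cst.
by apply: (Ck_in_prod openU) => i; exact: CM.
Qed.

Lemma Ck_in_invmx (R : realType) (V : normedModType R) (U : set V) k n
    (M : V -> 'M[R]_n) i j : open U -> (forall q, U q -> \det (M q) != 0) ->
  (forall i j, Ck_in k U (fun q => M q i j)) -> Ck_in k U (fun q => invmx (M q) i j).
Proof.
move=> openU M0 CM.
apply: (Ck_in_eq openU (f := fun q => (\det (M q))^-1 * cofactor (M q) j i)).
  by move=> q Uq; rewrite /invmx unitmxE unitfE M0// !mxE.
apply: (Ck_in_mul openU).
  by apply: (Ck_in_inv openU) => //; exact: Ck_in_det.
apply: (Ck_in_mul openU); first exact: Ck_in_cst.
apply: (Ck_in_det openU) => a b.
by apply: (Ck_in_eq openU _ (CM (lift j a) (lift i b))) => q _; rewrite !mxE.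
Qed.

Lemma dir_slice_sum (R : realType) n (z : 'cV[R]_n) :
  ((z, 0) : 'cV[R]_n * R) = \sum_l z l 0 *: label_dir R l.
Proof.
apply: injective_projections => /=.
  rewrite (raddf_sum (fst : {additive 'cV[R]_n * R -> 'cV[R]_n})) /=.
  exact: col_sum_delta.
rewrite (raddf_sum (snd : {additive 'cV[R]_n * R -> R})) /=.
by rewrite big1// => i _; rewrite /GRing.scale/= mulr0.
Qed.

Section chart_construction.
Variables (R : realType) (d : nat).
Local Notation n := d.+1.
Notation E := ('cV[R]_n * R)%type.
Variables (T : R) (G0 : set 'cV[R]_n) (X : 'cV[R]_n -> R -> 'cV[R]_n).
Variables (U0 : set 'cV[R]_n) (phi : 'cV[R]_n -> R) (U : set E) (Xh : 'I_n -> E -> R).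
Hypothesis ext : local_extension T G0 X U0 phi U Xh.

Let openU : open U := ext_open ext.
Let phih (q : E) : R := phi q.1.

Definition jac (q : E) : 'M[R]_n := \matrix_(m, l) 'D_(label_dir R l) (Xh m) q.
(** The inverse of the transposed Jacobian, and the ambient gradient of [phi]. *)
Definition dual (m k : 'I_n) (q : E) : R := invmx (jac q) k m.
Definition conormal m (q : E) : R := \sum_k dual m k q * 'D_(label_dir R k) phih q.
Definition conorm2 (q : E) : R := \sum_m conormal m q * conormal m q.

Let U1 := [set q | U q /\ \det (jac q) != 0].
Definition chart_domain := [set q | U1 q /\ conorm2 q != 0].

Lemma Ck_in_lift_phi : Ck_in 3 U phih.
Proof.
apply: (Ck_in_subset (U := [set q : E | U0 q.1])).
  by move=> q Uq; exact: ext_sub ext _ Uq.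
exact: Ck_in_fst (ext_open0 ext) (ext_phi ext).
Qed.

Lemma Ck_in_jac i j : Ck_in 2 U (fun q => jac q i j).
Proof.
apply: (Ck_in_eq openU _ (Ck_in_derive (label_dir R j) (ext_CX ext i))) => q _.
by rewrite mxE.
Qed.

Lemma openU1 : open U1.
Proof.
apply: open_neq0_in => // q Uq.
exact: (Ck_in_continuous (Ck_in_det openU Ck_in_jac) Uq).
Qed.

Lemma Ck_in_dual m k : Ck_in 2 U1 (dual m k).
Proof.
apply: (Ck_in_invmx _ _ openU1) => [q [_ +]//|i j].
by apply: Ck_in_subset (Ck_in_jac i j) => q [].
Qed.

Lemma Ck_in_conormal m : Ck_in 2 U1 (conormal m).
Proof.
apply: (Ck_in_sum openU1) => k; apply: (Ck_in_mul openU1); first exact: Ck_in_dual.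
apply: Ck_in_derive; apply: Ck_in_subset Ck_in_lift_phi.
by move=> q [].
Qed.

Lemma Ck_in_conorm2 : Ck_in 2 U1 conorm2.
Proof.
by apply: (Ck_in_sum openU1) => m; apply: (Ck_in_mul openU1); exact: Ck_in_conormal.
Qed.

Lemma open_chart_domain : open chart_domain.
Proof.
apply: open_neq0_in; first exact: openU1.
by move=> q Uq; exact: (Ck_in_continuous Ck_in_conorm2 Uq).
Qed.

Lemma conorm2_gt0 q : chart_domain q -> 0 < conorm2 q.
Proof.
move=> [_ q0]; rewrite lt0r q0 /=; apply: sumr_ge0 => m _.
by rewrite -expr2 sqr_ge0.
Qed.

Lemma jac_dual q : U1 q -> forall l k,
  \sum_m 'D_(label_dir R l) (Xh m) q * dual m k q = (l == k)%:R.
Proof.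
move=> [_ dq] l k.
have /matrixP/(_ k l) : invmx (jac q) *m jac q = 1%:M by rewrite mulVmx// unitmxE unitfE.
rewrite !mxE eq_sym => <-; apply: eq_bigr => m _.
by rewrite [jac q m l]mxE mulrC.
Qed.

Lemma dual_jac q : U1 q -> forall m j,
  \sum_k dual m k q * 'D_(label_dir R k) (Xh j) q = (m == j)%:R.
Proof.
move=> [_ dq] m j.
have /matrixP/(_ j m) : jac q *m invmx (jac q) = 1%:M by rewrite mulmxV// unitmxE unitfE.
rewrite !mxE eq_sym => <-; apply: eq_bigr => k _.
by rewrite [jac q j k]mxE mulrC.
Qed.

(** The Jacobian maps the ambient gradient of [phi] back to its label gradient, which
    does not vanish on the initial surface. *)
Lemma conormal_neq0 q : U1 q -> G0 q.1 -> conorm2 q != 0.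
Proof.
move=> U1q Gq; have [Uq _] := U1q; apply: contraNN (ext_grad ext (ext_sub ext Uq) Gq) => /eqP s0.
have c0 m : conormal m q = 0.
  have : [forall m, conormal m q == 0].
    apply/negPn; rewrite negb_forall; apply/negP => /existsP[i ci].
    have : 0 < conorm2 q.
      rewrite /conorm2 (bigD1 i)//= ltr_pwDl//.
        by rewrite -expr2 exprn_even_gt0.
      by apply: sumr_ge0 => j _; rewrite -expr2 sqr_ge0.
    by rewrite s0 ltxx.
  by move=> /forallP/(_ m)/eqP.
apply/eqP/colP => l; rewrite !mxE.
have -> : 'D_(delta_mx l 0) phi q.1 = 'D_(label_dir R l) phih q.
  by rewrite derive_fst//; exact: (differentiable_phi ext).
transitivity (\sum_m 'D_(label_dir R l) (Xh m) q * conormal m q); last first.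
  by rewrite big1// => m _; rewrite c0 mulr0.
rewrite -(sum_delta l (fun k => 'D_(label_dir R k) phih q)).
under eq_bigr do rewrite -(jac_dual U1q) mulr_suml.
rewrite exchange_big; apply: eq_bigr => m _; rewrite mulr_sumr.
by apply: eq_bigr => k _; rewrite mulrA.
Qed.

(** The factor [s] is an orientation, 1 or -1, to be matched with a given normal. *)
Lemma chart_of_extension (s : R) : s * s = 1 ->
  adapted_chart chart_domain Xh (fun m q => s * (conormal m q / Num.sqrt (conorm2 q)))
    dual phih (fun q => s * Num.sqrt (conorm2 q)).
Proof.
move=> ss; have oW := open_chart_domain.
have sub1 : chart_domain `<=` U1 by move=> q [].
have sub : chart_domain `<=` U by move=> q [[]].
have sq0 q : chart_domain q -> Num.sqrt (conorm2 q) != 0.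
  by move=> Wq; rewrite gt_eqF// sqrtr_gt0 conorm2_gt0.
have sqK q : chart_domain q -> Num.sqrt (conorm2 q) * Num.sqrt (conorm2 q) = conorm2 q.
  by move=> Wq; rewrite -expr2 sqr_sqrtr// ltW// conorm2_gt0.
split.
- exact: oW.
- by move=> i; apply: Ck_in_subset (ext_CX ext i).
- move=> i; apply: (Ck_in_mul oW); first exact: Ck_in_cst.
  apply: (Ck_in_mul oW); first exact: Ck_in_subset (Ck_in_conormal i).
  apply: (Ck_in_inv oW); first exact: sq0.
  apply: (Ck_in_sqrt oW); first exact: conorm2_gt0.
  exact: Ck_in_subset Ck_in_conorm2.
- by move=> i j; exact: Ck_in_subset (Ck_in_dual i j).
- by apply: (Ck_in_le (k := 3)) => //; exact: Ck_in_subset Ck_in_lift_phi.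
- by move=> q /sub1; exact: dual_jac.
- by move=> q /sub1; exact: jac_dual.
- move=> q Wq m; rewrite -/(conormal m q).
  have := sq0 q Wq; move: (conormal m q) (Num.sqrt _) => a b b0.
  have -> : s * b * (s * (a / b)) = (s * s) * a by field.
  by rewrite ss mul1r.
- move=> q Wq; rewrite mulf_neq0 ?sq0//.
  by apply/eqP => s0; move: ss; rewrite s0 mul0r => /eqP; rewrite eq_sym oner_eq0.
- move=> q Wq.
  have -> : 1 = s * s * (Num.sqrt (conorm2 q))^-1 ^+ 2 * conorm2 q.
    by rewrite -[in X in _ * X](sqK q Wq) ss; field; exact: sq0.
  rewrite mulr_sumr; apply: eq_bigr => m _; ring.
- move=> q Wq; rewrite /phih derive_fst; last exact: (differentiable_phi ext (sub q Wq)).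
  exact: derive0.
Qed.

End chart_construction.

Lemma adapted_chart_subset (R : realType) n (W' W : set ('cV[R]_n * R)) X N L phi r :
  open W' -> W' `<=` W -> adapted_chart W X N L phi r -> adapted_chart W' X N L phi r.
Proof.
move=> oW' sub [oW CX CN CL Cphi LX XL Lphi r0 N1 pt0]; split => //.
- by move=> i; exact: Ck_in_subset (CX i).
- by move=> i; exact: Ck_in_subset (CN i).
- by move=> i j; exact: Ck_in_subset (CL i j).
- exact: Ck_in_subset Cphi.
- by move=> q /sub; exact: LX.
- by move=> q /sub; exact: XL.
- by move=> q /sub; exact: Lphi.
- by move=> q /sub; exact: r0.
- by move=> q /sub; exact: N1.
- by move=> q /sub; exact: pt0.
Qed.

Lemma local_extension_subset (R : realType) d (T : R) G0 X (U0 : set 'cV[R]_d.+1) phi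
    U' U Xh : open U' -> U' `<=` U ->
  local_extension T G0 X U0 phi U Xh -> local_extension T G0 X U0 phi U' Xh.
Proof.
move=> oU' sub [ou0 p0 g0 gr oU s0 tm CX XX]; split => //.
- by move=> q /sub; exact: s0.
- by move=> q /sub; exact: tm.
- by move=> i; exact: Ck_in_subset (CX i).
- by move=> q i /sub; exact: XX.
Qed.

(** * Making the label Jacobian invertible *)

Lemma dotv_comm (R : realType) n (u w : 'cV[R]_n) : dotv u w = dotv w u.
Proof. by apply: eq_bigr => i _; rewrite mulrC. Qed.

Lemma dotvDr (R : realType) n (u w z : 'cV[R]_n) : dotv u (w + z) = dotv u w + dotv u z.
Proof. by rewrite -big_split; apply: eq_bigr => i _; rewrite mxE mulrDr. Qed.

Lemma dotvZr (R : realType) n a (u w : 'cV[R]_n) : dotv u (a *: w) = a * dotv u w.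
Proof. by rewrite /dotv mulr_sumr; apply: eq_bigr => i _; rewrite mxE mulrCA. Qed.

Lemma dotv0r (R : realType) n (u : 'cV[R]_n) : dotv u 0 = 0.
Proof. by rewrite /dotv big1// => i _; rewrite mxE mulr0. Qed.

Lemma dotv_gt0 (R : realType) n (u : 'cV[R]_n) : u != 0 -> 0 < dotv u u.
Proof.
move=> u0; have [i ui] : exists i, u i 0 != 0.
  apply/existsP; apply: contraNT u0; rewrite negb_exists => /forallP H.
  by apply/eqP/colP => i; rewrite mxE; apply/eqP; have := H i; rewrite negbK.
rewrite /dotv (bigD1 i)//= ltr_pwDl//; first by rewrite -expr2 exprn_even_gt0.
by apply: sumr_ge0 => j _; rewrite -expr2 sqr_ge0.
Qed.

Lemma derive_grad (R : realType) n (f : 'cV[R]_n.+1 -> R) x tau :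
  differentiable f x -> 'D_tau f x = dotv tau (grad f x).
Proof.
move=> df; have -> : 'D_tau f x = 'D_(\sum_i tau i 0 *: delta_mx i 0) f x.
  by rewrite [X in derive f x X](col_sum_delta tau).
by rewrite derive_direction_sum//; apply: eq_bigr => i _; rewrite mxE.
Qed.

Section invertible_extension.
Variables (R : realType) (d : nat).
Local Notation n := d.+1.
Notation E := ('cV[R]_n * R)%type.
Variables (T : R) (G0 : set 'cV[R]_n) (X : 'cV[R]_n -> R -> 'cV[R]_n).
Variables (U0 : set 'cV[R]_n) (phi : 'cV[R]_n -> R) (U : set E) (Xh : 'I_n -> E -> R).
Hypothesis ext : local_extension T G0 X U0 phi U Xh.
Notation Xcol := (Xcol Xh).

Lemma local_extension_shift (w : 'cV[R]_n) :
  local_extension T G0 X U0 phi U (fun i q => Xh i q + phi q.1 * w i 0).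
Proof.
have [ou0 p0 g0 gr oU s0 tm CX XX] := ext.
split; [exact: ou0|exact: p0|exact: g0|exact: gr|exact: oU|exact: s0|exact: tm|..].
- move=> i; apply: (Ck_in_add oU); first exact: CX.
  apply: (Ck_in_mul oU); last exact: Ck_in_cst.
  exact: (Ck_in_lift_phi ext).
- move=> q i Uq Gq; rewrite (XX q i Uq Gq) (_ : phi q.1 = 0) ?mul0r ?addr0//.
  by apply/(g0 _ (s0 _ Uq)).
Qed.

Variable q : E.
Hypotheses (Uq : U q) (Gq : G0 q.1).

(** The flow map at a fixed time has a differentiable left inverse on the surface, so it
    kills no tangent vector. *)
Lemma immersion (tau : 'cV[R]_n) :
  (exists Y, Ck_on 3 (surface G0 X q.2) Y /\ forall p, G0 p -> Y (X p q.2) = p) ->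
  'D_tau phi q.1 = 0 -> 'D_(tau, 0) Xcol q = 0 -> tau = 0.
Proof.
move=> [Y [CY YX]] tan D0; have [c [c0 cG dc]] := surface_curve ext Uq Gq tan.
have q0 : (c 0, q.2) = q by rewrite c0 -surjective_pairing.
have [|U' [Y' [oU' U'x CY' Y'Y]]] := CY (X q.1 q.2); first by exists q.1.
have dY : differentiable Y' (X q.1 q.2) by exact: (Ck_in_differentiable _ CY' U'x).
have dX : differentiable Xcol (c 0, q.2) by rewrite q0; exact: (differentiable_Xcol ext).
have de := is_derive_curve (is_derive_slice_curve q.2 dc) dX.
rewrite q0 D0 in de.
have e0 : (Xcol \o (fun s => (c s, q.2))) 0 = X q.1 q.2.
  by rewrite /= q0 (XcolE ext).
have dY' : differentiable Y' ((Xcol \o (fun s => (c s, q.2))) 0) by rewrite e0.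
have := is_derive_curve de dY'; rewrite derive0 => dYe.
have nU' : \forall y \near (Xcol \o (fun s => (c s, q.2))) 0, U' y.
  by apply: open_nbhs_nbhs; split; rewrite ?e0.
have cU' : \forall s \near (0 : R), U' (Xcol (c s, q.2)).
  by exact: (is_derive_continuous de nU').
have [_ <-] := dc; have [_ <-] := dYe.
apply: near_eq_derive; apply: filterS2 cG cU' => s [Gs Us] Us'.
rewrite /= Y'Y//; last by rewrite (XcolE ext Us Gs); exists (c s).
by rewrite (XcolE ext Us Gs) YX.
Qed.

(** The extension [Xh] is arbitrary across the initial surface, so its Jacobian may
    degenerate in the normal direction.  The correction [w] is chosen such that the
    shifted Jacobian maps the gradient g of [phi] to |g|^2 times the unit normal
    [nu0]; it is then injective, since tangent vectors are mapped injectively to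
    vectors orthogonal to [nu0]. *)
Lemma exists_invertible_shift (nu0 : 'cV[R]_n) :
  (exists Y, Ck_on 3 (surface G0 X q.2) Y /\ forall p, G0 p -> Y (X p q.2) = p) ->
  dotv nu0 nu0 = 1 ->
  (forall tau, tangent_vector (surface G0 X q.2) (X q.1 q.2) tau -> dotv nu0 tau = 0) ->
  exists w : 'cV[R]_n, \det (jac (fun i q => Xh i q + phi q.1 * w i 0) q) != 0.
Proof.
move=> hY nn tann.
pose g := grad phi q.1; have g0 : g != 0 by exact: ext_grad ext _ (ext_sub ext Uq) Gq.
have gg := dotv_gt0 g0.
have dp := differentiable_phi ext Uq.
have dX := differentiable_Xcol ext Uq.
exists (nu0 - (dotv g g)^-1 *: 'D_(g, 0) Xcol q).
set w := nu0 - _; apply/negP => /eqP det0; have := det0.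
rewrite -det_tr => /eqP/det0P[v v0 vK]; move/eqP: v0; apply.
pose z : 'cV[R]_n := v^T.
suff : z = 0 by move=> /(congr1 trmx); rewrite trmxK trmx0.
have Kz : 'D_(z, 0) Xcol q + 'D_z phi q.1 *: w = 0.
  have : jac (fun i q => Xh i q + phi q.1 * w i 0) q *m z = 0.
    by apply: trmx_inj; rewrite trmx_mul trmxK vK trmx0.
  move=> e; rewrite -[RHS]e; apply/colP => m; rewrite mxE (derive_Xcol ext _ m Uq) mxE.
  have dm : differentiable (Xh m) q by exact: (Ck_in_differentiable _ (ext_CX ext m) Uq).
  have dpq : differentiable (fun q : E => phi q.1) q.
    by exact: (Ck_in_differentiable _ (Ck_in_lift_phi ext) Uq).
  have dmp : differentiable (fun q : E => phi q.1 * w m 0) q.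
    by apply: differentiableM => //; exact: differentiable_cst.
  transitivity ('D_(z, 0) (fun q => Xh m q + phi q.1 * w m 0) q).
    rewrite derive_addf//; congr (_ + _).
    rewrite derive_mulf//.
    by rewrite derive_cst mulr0 addr0 derive_fst// mxE.
  rewrite dir_slice_sum derive_direction_sum; last exact: differentiableD.
  rewrite [RHS]mxE; apply: eq_bigr => l _.
  by rewrite [jac _ _ m l]mxE; exact: mulrC.
(* A kernel vector z is split into a tangential part and a multiple of g. *)
pose a := 'D_z phi q.1; pose tau := z - (a / dotv g g) *: g.
have tan : 'D_tau phi q.1 = 0.
  rewrite (derive_grad _ dp) -/g dotv_comm /tau dotvDr -scaleNr dotvZr /a.
  by rewrite (derive_grad _ dp) -/g (dotv_comm g); field; rewrite gt_eqF.
have Dz : 'D_(z, 0) Xcol q = 'D_(tau, 0) Xcol q + (a / dotv g g) *: 'D_(g, 0) Xcol q.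
  rewrite !deriveE// -linearZ -linearD; congr ('d _ _ _).
  apply: injective_projections; rewrite /= ?subrK//.
  by rewrite /GRing.scale/= mulr0 addr0.
have key : 'D_(tau, 0) Xcol q + a *: nu0 = 0.
  rewrite -[RHS]Kz Dz -/a /w scalerBr scalerA; apply/esym.
  rewrite -addrA; congr (_ + _).
  by rewrite addrCA subrr addr0.
have ta := tangent_Xcol ext Uq Gq tan.
have a0 : a = 0.
  have := dotv0r nu0; rewrite -key dotvDr (tann _ ta) dotvZr nn mulr1 add0r.
  by [].
have tau0 : tau = 0.
  by apply: immersion => //; move: key; rewrite a0 scale0r addr0.
by move: tau0; rewrite /tau a0 mul0r scale0r subr0.
Qed.

End invertible_extension.

(** * Tangential gradients in label coordinates, and existence of charts *)

Section surface_gradient.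
Variables (R : realType) (d : nat).
Local Notation n := d.+1.
Notation E := ('cV[R]_n * R)%type.
Variables (T : R) (G0 : set 'cV[R]_n) (X : 'cV[R]_n -> R -> 'cV[R]_n).
Variables (U0 : set 'cV[R]_n) (phi : 'cV[R]_n -> R) (W : set E) (Xh : 'I_n -> E -> R).
Hypothesis ext : local_extension T G0 X U0 phi W Xh.
Variables (N : 'I_n -> E -> R) (L : 'I_n -> 'I_n -> E -> R) (r : E -> R).
Hypothesis chart : adapted_chart W Xh N L (fun q => phi q.1) r.
Notation Xcol := (Xcol Xh).
Notation td := (td N L).
Implicit Types (q : E).

Lemma td_dir_slice i q : td_dir N L i q = ((td_dir N L i q).1, 0).
Proof.
rewrite [LHS]surjective_pairing; congr (_, _).
rewrite /td_dir (raddf_sum (snd : {additive 'cV[R]_n * R -> R})) big1// => k _.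
by rewrite /= /GRing.scale/= mulr0.
Qed.

Lemma td_dir_tangent i q : W q -> 'D_(td_dir N L i q).1 phi q.1 = 0.
Proof.
move=> Wq; rewrite -(derive_fst (f := phi)); last exact: (differentiable_phi ext).
exact: (td_phi chart i Wq).
Qed.

(** [slice_local] applies to [td i] because its direction is tangential. *)
Lemma td_local i (F G : E -> R) q : W q -> G0 q.1 ->
  differentiable F q -> differentiable G q ->
  (forall z, W z -> G0 z.1 -> F z = G z) -> td i F q = td i G q.
Proof.
move=> Wq Gq dF dG FG; rewrite /td td_dir_slice.
exact: (slice_local ext Wq Gq (td_dir_tangent i Wq) dF dG FG).
Qed.

Lemma tangent_vector_proj i q : W q -> G0 q.1 ->
  tangent_vector (surface G0 X q.2) (X q.1 q.2) (\col_m tangent_proj N i m q).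
Proof.
move=> Wq Gq; have := tangent_Xcol ext Wq Gq (td_dir_tangent i Wq).
rewrite -td_dir_slice; congr (tangent_vector _ _ _).
apply/colP => m; rewrite (derive_Xcol ext _ m Wq) mxE.
exact: (td_coordinates chart i m Wq).
Qed.

(** The columns of the projection I - N N^T are tangent to the surface, so a vector
    orthogonal to the surface is a multiple of N. *)
Lemma unit_normal_sign (nu0 : 'cV[R]_n) q : W q -> G0 q.1 ->
  dotv nu0 nu0 = 1 ->
  (forall tau, tangent_vector (surface G0 X q.2) (X q.1 q.2) tau -> dotv nu0 tau = 0) ->
  exists2 s : R, s * s = 1 & forall i, nu0 i 0 = s * N i q.
Proof.
move=> Wq Gq nn tann; pose s := \sum_m nu0 m 0 * N m q.
have e i : nu0 i 0 = s * N i q.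
  have := tann _ (tangent_vector_proj i Wq Gq).
  have -> : dotv nu0 (\col_m tangent_proj N i m q) = nu0 i 0 - s * N i q.
    rewrite /s mulr_suml -[X in X - _](sum_delta i (fun m => nu0 m 0)) -sumrB.
    by apply: eq_bigr => m _; rewrite mxE /tangent_proj; ring.
  by move/eqP; rewrite subr_eq0 => /eqP.
exists s => //; rewrite -[RHS]nn /dotv.
rewrite -[LHS]mulr1 -(chart_N1 chart Wq) mulr_sumr.
by apply: eq_bigr => i _; rewrite e; ring.
Qed.

Variable nu : 'cV[R]_n -> R -> 'cV[R]_n.
Hypothesis nuN : forall q i, W q -> G0 q.1 -> nu (X q.1 q.2) q.2 i 0 = N i q.

Section at_point.
Variables (f : 'cV[R]_n -> R) (F : E -> R) (q : E).
Hypotheses (Wq : W q) (Gq : G0 q.1) (dF : differentiable F q).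
Hypothesis fF : forall p, W (p, q.2) -> G0 p -> f (X p q.2) = F (p, q.2).

Let M := surface G0 X q.2.
Let nut := fun y => nu y q.2.

(** Along the curve that [X] carries to the i-th column of the projection, the
    extension [ubar] and the label function [F] have the same values; so the i-th
    component of the projected gradient of [ubar] is [td i F]. *)
Lemma is_tgrad_td g : is_tgrad M nut f (X q.1 q.2) g -> g = \col_i td i F q.
Proof.
move=> [ubar [du uf ->]]; apply/colP => i; rewrite [RHS]mxE.
have tan := td_dir_tangent i Wq.
have [c [c0 cG dc]] := surface_curve ext Wq Gq tan.
have q0 : (c 0, q.2) = q by rewrite c0 -surjective_pairing.
have dX : differentiable Xcol (c 0, q.2) by rewrite q0; exact: (differentiable_Xcol ext).
have ds := is_derive_slice_curve q.2 dc.
have de := is_derive_curve ds dX.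
rewrite q0 -td_dir_slice in de.
have e0 : (Xcol \o (fun s => (c s, q.2))) 0 = X q.1 q.2.
  by rewrite /= q0 (XcolE ext).
have du' : differentiable ubar ((Xcol \o (fun s => (c s, q.2))) 0) by rewrite e0.
have D1 := is_derive_curve de du'.
have dF' : differentiable F (c 0, q.2) by rewrite q0.
have D2 := is_derive_curve ds dF'.
rewrite q0 -td_dir_slice in D2; rewrite e0 in D1.
have uf' : \forall y \near (Xcol \o (fun s => (c s, q.2))) 0, M y -> ubar y = f y.
  by rewrite e0.
have cu : \forall s \near (0 : R), M (Xcol (c s, q.2)) -> ubar (Xcol (c s, q.2)) = f (Xcol (c s,
    q.2)).
  exact: (is_derive_continuous de uf').
have -> : td i F q = 'D_('D_(td_dir N L i q) Xcol q) ubar (X q.1 q.2).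
  have [_ E1] := D1; have [_ E2] := D2.
  rewrite -E1 /td -E2; apply: near_eq_derive.
  apply: filterS2 cG cu => s [Gs Ws] us /=.
  rewrite us; last by rewrite (XcolE ext Ws Gs); exists (c s).
  by rewrite (XcolE ext Ws Gs) -fF.
rewrite (derive_grad _ du).
have -> : 'D_(td_dir N L i q) Xcol q = \col_m tangent_proj N i m q.
  apply/colP => m; rewrite (derive_Xcol ext _ m Wq) mxE.
  exact: (td_coordinates chart i m Wq).
move: (grad ubar (X q.1 q.2)) => a.
rewrite mxE [X in _ + X]mxE [X in _ - X]mxE /nut (nuN i Wq Gq).
have -> : dotv a (nu (X q.1 q.2) q.2) = \sum_m a m 0 * N m q.
  by apply: eq_bigr => m _; rewrite (nuN m Wq Gq).
rewrite -[X in X - _](sum_delta i (fun m => a m 0)) mulr_suml -sumrB.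
by apply: eq_bigr => m _; rewrite mxE /tangent_proj; ring.
Qed.

(** An extension is obtained by composing [F] with an extension of the inverse of the
    flow map. *)
Lemma exists_is_tgrad :
  (exists Y, Ck_on 3 M Y /\ forall p, G0 p -> Y (X p q.2) = p) ->
  exists g, is_tgrad M nut f (X q.1 q.2) g.
Proof.
move=> [Y [CY YX]].
have [|U' [Y' [oU' U'x CY' Y'Y]]] := CY (X q.1 q.2); first by exists q.1.
have dY : differentiable Y' (X q.1 q.2) by exact: (Ck_in_differentiable _ CY' U'x).
have Y'x : Y' (X q.1 q.2) = q.1 by rewrite Y'Y// ?YX//; exists q.1.
have dF' : differentiable F (Y' (X q.1 q.2), q.2) by rewrite Y'x -surjective_pairing.
have du : differentiable (fun y => F (Y' y, q.2)) (X q.1 q.2).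
  apply: (differentiable_comp (f := Y') (g := fun y => F (y, q.2))) => //.
  exact: differentiable_slice.
eexists; exists (fun y => F (Y' y, q.2)); split; [exact: du| |reflexivity].
have cY : {for X q.1 q.2, continuous (fun y => (Y' y, q.2))}.
  apply: differentiable_continuous; exact: differentiable_pair.
have nW : \forall z \near (Y' (X q.1 q.2), q.2), W z.
  apply: open_nbhs_nbhs; split; first exact: ext_open ext.
  by rewrite Y'x -surjective_pairing.
have h1 : \forall y \near X q.1 q.2, W (Y' y, q.2) by exact: (cY _ nW).
have h2 : \forall y \near X q.1 q.2, U' y by exact: open_nbhs_nbhs.
apply: filterS2 h1 h2 => y + U'y My; rewrite (Y'Y y U'y My).
by case: My => p Gp <-; rewrite YX// => Wp; rewrite fF.
Qed.

Lemma tgrad_td :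
  (exists Y, Ck_on 3 M Y /\ forall p, G0 p -> Y (X p q.2) = p) ->
  tgrad M nut f (X q.1 q.2) = \col_i td i F q.
Proof.
by move=> hY; apply: is_tgrad_td; apply: xgetPex; exact: exists_is_tgrad.
Qed.

End at_point.
End surface_gradient.

Section flow_chart.
Variables (R : realType) (d : nat).
Local Notation n := d.+1.
Notation E := ('cV[R]_n * R)%type.
Variables (T : R) (G0 : set 'cV[R]_n) (X nu : 'cV[R]_n -> R -> 'cV[R]_n).
Hypothesis hX : evolving_surface 3 T G0 X.
Hypothesis hnu : outward_unit_normal T G0 X nu.
Variables (p : 'cV[R]_n) (t : R).
Hypotheses (Gp : G0 p) (ht : 0 < t < T).

Lemma exists_local_extension : exists U0 phi U (Xh : 'I_n -> E -> R),
  local_extension T G0 X U0 phi U Xh /\ U (p, t).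
Proof.
have [[_ Gdef] CX _] := hX.
have [U0 [phi [oU0 U0p Cphi G0phi gphi]]] := Gdef p Gp.
have tT : (G0 `*` `[0, T]%classic) (p, t).
  by split => //=; rewrite in_itv/=; case/andP: ht => /ltW -> /ltW ->.
have [U1 [F [oU1 U1p CF FX]]] := CX (p, t) tT.
pose U2 : set E := [set q | U0 q.1]; pose U3 : set E := [set q | 0 < q.2 /\ q.2 < T].
have oU2 : open U2 by apply: open_comp oU0 => q _; exact: cvg_fst.
have oU3 : open U3.
  apply: openI.
    apply: (open_comp (f := snd) (D := [set x : R | 0 < x])); last exact: open_gt.
    by move=> q _; exact: cvg_snd.
  apply: (open_comp (f := snd) (D := [set x : R | x < T])); last exact: open_lt.
  by move=> q _; exact: cvg_snd.
exists U0, phi, (U1 `&` U2 `&` U3), (fun i q => F q i 0); split; last first.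
  by split; [split|case/andP: ht].
have oU : open (U1 `&` U2 `&` U3) by apply: openI => //; exact: openI.
split.
- exact: oU0.
- exact: Cphi.
- exact: G0phi.
- exact: gphi.
- exact: oU.
- by move=> q [[_ +] _].
- by move=> q [_ [-> ->]].
- move=> i; apply: (Ck_in_coord oU); apply: Ck_in_subset CF.
  by move=> q [[]].
- move=> q i [[Uq _] [q0 qT]] Gq; rewrite FX//; split => //=.
  by rewrite in_itv/= !ltW.
Qed.

Lemma exists_inverse s : 0 < s < T ->
  exists Y, Ck_on 3 (surface G0 X s) Y /\ forall p, G0 p -> Y (X p s) = p.
Proof.
move=> /andP[s0 sT]; have [_ _ H] := hX.
by have [|_ +] := H s; rewrite ?ltW.
Qed.

Lemma nu_unit s : 0 < s < T -> unit_normal (surface G0 X s) (fun y => nu y s).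
Proof.
move=> /andP[s0 sT]; have [_ H] := hnu.
by have [|+ _] := H s; rewrite ?ltW.
Qed.

(** The extension is corrected to have an invertible Jacobian at (p, t), the sign of
    N is taken from the given normal at (p, t), and by continuity along the flow the
    sign stays the same nearby. *)
Lemma exists_flow_chart : exists U0 phi W (Xh N : 'I_n -> E -> R) L r,
  [/\ local_extension T G0 X U0 phi W Xh,
      adapted_chart W Xh N L (fun q => phi q.1) r, W (p, t) &
      forall q i, W q -> G0 q.1 -> nu (X q.1 q.2) q.2 i 0 = N i q].
Proof.
have [U0 [phi [U [Xh0 [ext0 Up]]]]] := exists_local_extension.
have nut := nu_unit ht.
have Mx : surface G0 X t (X p t) by exists p.
have [nn tann] := nut _ Mx.
have [w detw] := exists_invertible_shift (q := (p, t)) ext0 Up Gp (exists_inverse ht) nn tann.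
pose Xh i q := Xh0 i q + phi q.1 * w i 0.
have ext : local_extension T G0 X U0 phi U Xh by exact: local_extension_shift.
pose W1 := chart_domain phi U Xh.
have W1p : W1 (p, t).
  by split; [split|apply: (conormal_neq0 ext)]; first [exact: Up|exact: detw|exact: Gp|split].
have oW1 : open W1 by exact: (open_chart_domain ext).
have sub1 : W1 `<=` U by move=> q [[]].
have ext1 : local_extension T G0 X U0 phi W1 Xh by exact: local_extension_subset ext.
have chart1 := chart_of_extension ext (mulr1 1).
have [s ss nus] := unit_normal_sign ext1 chart1 W1p Gp nn tann.
have chart := chart_of_extension ext ss.
set N := fun m q => _ in chart.
have nuN0 i : nu (X p t) t i 0 = N i (p, t).
  by rewrite nus /N mul1r.
have sign q : W1 q -> G0 q.1 -> exists2 e : R, e * e = 1 &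
    forall i, nu (X q.1 q.2) q.2 i 0 = e * N i q.
  move=> Wq Gq; have tq := ext_time ext1 Wq.
  have Mq : surface G0 X q.2 (X q.1 q.2) by exists q.1.
  have [nq tq'] := nu_unit tq Mq.
  exact: (unit_normal_sign ext1 chart Wq Gq nq tq').
(* Where N_i does not vanish, the sign of nu_i N_i tells the two unit normals apart. *)
have [i Ni] : exists i, N i (p, t) != 0.
  apply: contrapT => H.
  have N0 j : N j (p, t) = 0 by apply: contrapT => /eqP nj; apply: H; exists j.
  have := chart_N1 chart W1p; rewrite big1 => [|j _]; last by rewrite N0 mul0r.
  by move/eqP; rewrite eq_sym oner_eq0.
pose S : set E := G0 `*` `[0, T]%classic.
have Sp : S (p, t).
  by split => //=; rewrite in_itv/=; case/andP: ht => /ltW -> /ltW ->.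
have pos : \forall q \near (p, t), S q -> 0 < nu (X q.1 q.2) q.2 i 0 * N i q.
  have [cnu _] := hnu; move/subspace_continuousP: cnu => /(_ _ Sp) cnu.
  have c1 : (fun q : E => nu (X q.1 q.2) q.2 i 0) @ within S (nbhs (p, t)) --> nu (X p t) t i 0.
    apply: (@cvg_comp _ _ _ (fun q : E => nu (X q.1 q.2) q.2) (fun M : 'cV[R]_n => M i 0) _ _ _
        cnu).
    exact: coord_continuous.
  have c2 : N i @ within S (nbhs (p, t)) --> N i (p, t).
    apply: cvg_within_filter.
    exact: (Ck_in_continuous (chart_CN chart i) W1p).
  have c3 := cvgM c1 c2.
  have pos0 : 0 < nu (X p t) t i 0 * N i (p, t).
    by rewrite nuN0 -expr2 exprn_even_gt0.
  have FS : Filter (within S (nbhs (p, t))) by exact: within_filter.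
  have h : \forall q \near within S (nbhs (p, t)), 0 < nu (X q.1 q.2) q.2 i 0 * N i q.
    by apply: (cvgr_gt (nu (X p t) t i 0 * N i (p, t)) (c3 FS)); exact: pos0.
  by move: h; rewrite near_withinE.
pose B : set E := interior [set q | S q -> 0 < nu (X q.1 q.2) q.2 i 0 * N i q].
have openB : open B by exact: open_interior.
have Bp : B (p, t) by exact: pos.
have BS q : B q -> S q -> 0 < nu (X q.1 q.2) q.2 i 0 * N i q by move=> /interior_subset.
have oW : open (W1 `&` B) by exact: openI.
have sub : W1 `&` B `<=` W1 by move=> q [].
exists U0, phi, (W1 `&` B), Xh, N; do 2 eexists; split.
- exact: local_extension_subset ext1.
- exact: adapted_chart_subset chart.
- by [].
- move=> q j [Wq Bq] Gq; have [e ee eN] := sign q Wq Gq.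
  have Sq : S q.
    by split => //=; rewrite in_itv/=; case/andP: (ext_time ext1 Wq) => /ltW -> /ltW ->.
  have := BS q Bq Sq; rewrite !eN => pe.
  suff -> : e = 1 by rewrite mul1r.
  have : (e - 1) * (e + 1) = 0 by rewrite -subr_sqr expr2 ee expr1n subrr.
  move/eqP; rewrite mulf_eq0 subr_eq0 addr_eq0 => /orP[/eqP//|/eqP em].
  move: pe; rewrite em mulN1r mulNr oppr_gt0 -expr2 => pe.
  by have := sqr_ge0 (N i q); rewrite leNgt pe.
Qed.

End flow_chart.

(** * The evolution equations on the surface *)

Theorem lemma3p1 (R : realType) (d : nat) (hd : (1 <= d <= 3)%N)
  (gamma beta : 'cV[R]_d.+1 -> R)
  (hgamma : anisotropy gamma) (hbeta : kinetic beta)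
  (T : R) (hT : 0 < T)
  (G0 : set 'cV[R]_d.+1) (X : 'cV[R]_d.+1 -> R -> 'cV[R]_d.+1)
  (hX : evolving_surface 3 T G0 X)
  (nu v : 'cV[R]_d.+1 -> R -> 'cV[R]_d.+1) (V : 'cV[R]_d.+1 -> R -> R)
  (hnu : outward_unit_normal T G0 X nu)
  (hflow : aniso_flow gamma beta T G0 X nu v V)
  (p : 'cV[R]_d.+1) (t : R) (hp : G0 p) (ht : 0 < t < T) :
  let x := X p t in
  let Gt := surface G0 X t in
  let nut := fun y => nu y t in
  let Vt := fun y => V y t in
  beta (nut x) *: matder X nu p t =
    tdivm Gt nut (fun y => hess gamma (nut y) *m tgradv Gt nut nut y) x
    + normA2 gamma Gt nut x *: nut x
    + Vt x *: (tgradv Gt nut nut x *m grad beta (nut x))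
  /\
  beta (nut x) * matder X V p t =
    tdiv Gt nut (fun y => hess gamma (nut y) *m tgrad Gt nut Vt y) x
    + normA2 gamma Gt nut x * Vt x
    + Vt x * dotv (tgrad Gt nut Vt x) (grad beta (nut x)).
Proof.
have [U0 [phi [W [Xh [N [L [r [ext chart Wpt nuN]]]]]]]] := exists_flow_chart hX hnu hp ht.
have [_ flow] := hflow.
have [_ [gammaC _] hom _] := hgamma.
have [betaC _] := hbeta.
pose pt (F : 'cV[R]_d.+1 * R -> R) := 'D_(time_dir R d.+1) F.
(* The normal part of the velocity of the extension is of class C^2 and equals V on
   the surface. *)
pose Vel q := \sum_m pt (Xh m) q * N m q.
have openW := chart_open chart.
have nearW y s : W (y, s) -> \forall z \near s, W (y, z).
  move=> Wys; have cc : {for s, continuous (fun z : R => (y, z))}.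
    by move=> A; apply: (cvg_pair (G := nbhs y) (H := nbhs s)); [exact: cvg_cst|exact: cvg_id].
  by apply: cc; apply: open_nbhs_nbhs.
have nuNv q : W q -> G0 q.1 -> nu (X q.1 q.2) q.2 = normal_col N q.
  by move=> Wq Gq; apply/colP => i; rewrite normal_colE nuN.
have speed q m : W q -> G0 q.1 -> pt (Xh m) q = V (X q.1 q.2) q.2 * N m q.
  case: q => y s Wq Gq; have tq := ext_time ext Wq.
  have [dX vV _] := flow y s Gq tq.
  have dXh : differentiable (Xh m) (y, s).
    exact: (Ck_in_differentiable _ (ext_CX ext m) Wq).
  have dXs : differentiable (X y) s by apply/derivable1_diffP; exact: ex_derive.
  have cW : \forall z \near s, W (y, z).
    exact: nearW.
  have [_ e0] := is_derive_time dXh; apply: etrans (esym e0) _.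
  transitivity ('D_1 (fun z => X y z m 0) s).
    apply: near_eq_derive; apply: filterS cW => z Wz.
    by rewrite -(ext_X ext m Wz Gq).
  have [_ e] := dX.
  by rewrite derive_entry// e vV mxE (nuN (y, s) m Wq Gq).
have VelV q : W q -> G0 q.1 -> V (X q.1 q.2) q.2 = Vel q.
  move=> Wq Gq; rewrite /Vel.
  under eq_bigr do rewrite (speed q _ Wq Gq) -mulrA.
  by rewrite -mulr_sumr (chart_N1 chart Wq) mulr1.
have VelC : Ck_in 2 W Vel.
  apply: (Ck_in_sum openW) => m; apply: (Ck_in_mul openW); last exact: chart_CN chart m.
  exact: (Ck_in_derive _ (ext_CX ext m)).
pose td := td N L.
have tgradE (f : 'cV[R]_d.+1 -> R) F q : W q -> G0 q.1 -> Ck_in 1 W F ->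
    (forall p', W (p', q.2) -> G0 p' -> f (X p' q.2) = F (p', q.2)) ->
    tgrad (surface G0 X q.2) (fun y => nu y q.2) f (X q.1 q.2) = \col_i td i F q.
  move=> Wq Gq CF fF.
  apply: (tgrad_td ext chart nuN Wq Gq (Ck_in_differentiable _ CF Wq) fF) => //.
  exact: (exists_inverse hX (ext_time ext Wq)).
have CN1 j : Ck_in 1 W (N j) by exact: Ck_in_le (chart_CN chart j).
have CG i : Ck_in 1 W (cahn_hoffman N gamma i) by exact: Ck_in_le (Ck_in_cahn_hoffman chart
    gammaC i).
have tgradvE q : W q -> G0 q.1 ->
    tgradv (surface G0 X q.2) (fun y => nu y q.2) (fun y => nu y q.2) (X q.1 q.2)
    = \matrix_(i, j) td i (N j) q.
  move=> Wq Gq; apply/matrixP => i j; rewrite !mxE.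
  rewrite (tgradE _ (N j)) ?mxE// => p' Wp Gp.
  exact: (nuN (p', q.2)).
have normal_velocity q m : W q -> G0 q.1 -> pt (Xh m) q = Vel q * N m q.
  by move=> Wq Gq; rewrite speed// VelV.
have curvature_law q : W q -> G0 q.1 -> beta (normal_col N q) * Vel q = - aniso_div N L gamma q.
  move=> Wq Gq; have [_ _] := flow q.1 q.2 Gq (ext_time ext Wq).
  rewrite (nuNv q Wq Gq) (VelV q Wq Gq) => ->; congr (- _).
  apply: eq_bigr => i _; rewrite mxE (tgradE _ (cahn_hoffman N gamma i)) ?mxE// => p' Wp Gp.
  by rewrite mxE (nuNv (p', q.2)).
have normalE := normal_evolution chart gammaC hom betaC VelC
  (fun i F G q Wq Sq => @td_local _ _ _ _ _ _ _ _ _ ext _ _ _ chart i F G q Wq Sq)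
  normal_velocity curvature_law Wpt hp.
have velocityE := velocity_evolution chart gammaC hom betaC VelC
  (fun i F G q Wq Sq => @td_local _ _ _ _ _ _ _ _ _ ext _ _ _ chart i F G q Wq Sq)
  (fun F G q Wq Sq => @pt_local _ _ _ _ _ _ _ _ _ ext F G q Wq Sq)
  normal_velocity curvature_law Wpt hp.
have matder_nu : matder X nu p t = \col_j pt (N j) (p, t).
  have dN j : differentiable (N j) (p, t) by exact: (Ck_in_differentiable _ (CN1 j) Wpt).
  have dNj j : is_derive t 1 (fun s => normal_col N (p, s) j 0) (pt (N j) (p, t)).
    apply: (near_eq_is_derive _ (is_derive_time (dN j))).
    by apply: filterE => s; rewrite normal_colE.
  rewrite /matder derive1E (near_eq_derive (g := fun s => normal_col N (p, s))); last first.
    by apply: filterS (nearW p t Wpt) => s Ws; exact: (nuNv (p, s)).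
  have dcol : differentiable (fun s => normal_col N (p, s)) t.
    apply: differentiable_col => j; apply/derivable1_diffP.
    by have := dNj j; case.
  by apply/colP => j; rewrite -derive_entry// mxE; have [_ ->] := dNj j.
have matder_V : matder X V p t = pt Vel (p, t).
  have dVel : differentiable Vel (p, t) by exact: (Ck_in_differentiable _ VelC Wpt).
  have [_ e] := is_derive_time dVel; rewrite -[RHS]e /matder derive1E.
  by apply: near_eq_derive; apply: filterS (nearW p t Wpt) => s Ws; exact: (VelV (p, s)).
move=> x Gt nut Vt.
have nux : nut x = normal_col N (p, t) by exact: (nuNv (p, t)).
have Vx : Vt x = Vel (p, t) by exact: (VelV (p, t)).
have tgradvx : tgradv Gt nut nut x = \matrix_(i, j) td i (N j) (p, t).
  exact: (tgradvE (p, t) Wpt hp).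
have tgradVE z : W z -> G0 z.1 -> z.2 = t ->
    tgrad Gt nut Vt (X z.1 t) = \col_i td i Vel z.
  case: z => y s Wz Gz /= st; subst s.
  apply: (tgradE Vt Vel (y, t)) => //; first exact: Ck_in_le VelC.
  by move=> p' Wp Gp; exact: (VelV (p', t)).
have normA2E : normA2 gamma Gt nut x = shape_norm2 N L gamma (p, t).
  rewrite /normA2 tgradvx nux /ddot /mxtrace; apply: eq_bigr => i _.
  rewrite mxE; apply: eq_bigr => m _; rewrite !mxE; congr (_ * _).
  by apply: eq_bigr => k _; rewrite !mxE.
have Chs1 i k : Ck_in 1 W (hess_normal N gamma i k) by exact: Ck_in_le (Ck_in_hess_normal chart
    gammaC i k).
have Ctd1 k F : Ck_in 2 W F -> Ck_in 1 W (td k F).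
  by move=> CF; apply: (Ck_in_td chart).
have tdivmE : tdivm Gt nut (fun y => hess gamma (nut y) *m tgradv Gt nut nut y) x =
    \col_j \sum_i td i (fun z => \sum_k hess_normal N gamma i k z * td k (N j) z) (p, t).
  apply/colP => j; rewrite !mxE; apply: eq_bigr => i _; rewrite mxE.
  rewrite (tgradE _ (fun z => \sum_k hess_normal N gamma i k z * td k (N j) z) (p, t)) ?mxE//.
    apply: (Ck_in_sum openW) => k; apply: (Ck_in_mul openW); first exact: Chs1.
    by apply: Ctd1; exact: chart_CN chart j.
  move=> p' Wp Gp; rewrite !mxE; apply: eq_bigr => k _.
  rewrite (tgradvE (p', t) Wp Gp) !mxE /nut.
  by rewrite (nuNv (p', t) Wp Gp).
have tdivE : tdiv Gt nut (fun y => hess gamma (nut y) *m tgrad Gt nut Vt y) x =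
    \sum_i td i (fun z => \sum_k hess_normal N gamma i k z * td k Vel z) (p, t).
  apply: eq_bigr => i _; rewrite mxE.
  rewrite (tgradE _ (fun z => \sum_k hess_normal N gamma i k z * td k Vel z) (p, t)) ?mxE//.
    apply: (Ck_in_sum openW) => k; apply: (Ck_in_mul openW); first exact: Chs1.
    exact: Ctd1.
  move=> p' Wp Gp; rewrite mxE; apply: eq_bigr => k _.
  rewrite (tgradVE (p', t) Wp Gp erefl) !mxE /nut.
  by rewrite (nuNv (p', t) Wp Gp).
split.
  rewrite matder_nu tdivmE normA2E tgradvx nux Vx; apply/colP => j.
  rewrite !mxE; apply: etrans (normalE j) _.
  congr (_ + _ + _); congr (_ * _).
  by apply: eq_bigr => k _; rewrite !mxE.
rewrite matder_V tdivE normA2E nux Vx (tgradVE (p, t) Wpt hp erefl).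
apply: etrans velocityE _; congr (_ + _ + _); congr (_ * _).
by apply: eq_bigr => k _; rewrite !mxE.
Qed.
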